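(* Let $(X_k)_{k=1}^\infty$ and $X$ be shift spaces over a finite alphabet $\mathscr{A}$ such that $\bar{d}^H_{\mathcal{M}}(\mathcal M_\sigma(X_k),\mathcal M_\sigma(X))\to0$ as $k\to\infty$. If the ergodic measures are entropy-dense in $\mathcal M_\sigma(X_k)$ for each $k\in\mathbb N$, then the ergodic measures are entropy-dense in $\mathcal M_\sigma(X)$.
   Context: $\mathcal M_\sigma(X)$ is the set of shift-invariant Borel probability measures supported on the shift space $X$, with the weak$^*$ topology; $\mathcal M^e_\sigma(X)$ its ergodic elements; $h(\mu)$ the Kolmogorov–Sinai entropy. Ergodic measures are entropy-dense for $X$ if for every $\mu\in\mathcal M_\sigma(X)$, every weak$^*$ neighbourhood $U$ of $\mu$ in $\mathcal M_\sigma(X)$ and every $\varepsilon>0$ there is $\nu\in\mathcal M^e_\sigma(X)\cap U$ with $|h(\nu)-h(\mu)|<\varepsilon$. Ornstein's metric: $\bar d_{\mathcal M}(\mu,\nu)=\inf_{\lambda\in J(\mu,\nu)}\int d_0\,d\lambda$, where $J(\mu,\nu)$ is the set of $\sigma\times\sigma$-invariant couplings of $\mu,\nu$ and $d_0(x,y)=1$ if $x_0\ne y_0$, else $0$; $\bar{d}^H_{\mathcal{M}}$ is the induced Hausdorff distance between nonempty subsets of $\mathcal M_\sigma(\mathscr{A}^\infty)$. *)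

(* Defs.v *)
From HB Require Import structures.
From mathcomp Require Import all_boot all_order all_algebra.
From mathcomp Require Import all_classical all_reals all_analysis.
Import Order.TTheory GRing.Theory Num.Theory.
Import numFieldNormedType.Exports.

Set Implicit Arguments.
Unset Strict Implicit.
Unset Printing Implicit Defensive.

Local Open Scope classical_set_scope.
Local Open Scope ring_scope.

(* The point a0 is only used to give the carrier the (required) pointedType *)
(* structure; it plays no mathematical role.                                 *)
Definition seqs (A : finType) (a0 : A) : Type := nat -> A.

HB.instance Definition _ (A : finType) (a0 : A) := gen_eqMixin (seqs a0).
HB.instance Definition _ (A : finType) (a0 : A) := gen_choiceMixin (seqs a0).
HB.instance Definition _ (A : finType) (a0 : A) :=
  isPointed.Build (seqs a0) (fun _ : nat => a0).

Section Shift.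
Variables (A : finType) (a0 : A).

Definition cyl (n : nat) (y : seqs a0) : set (seqs a0) :=
  [set x | forall i, (i < n)%N -> x i = y i].

Definition cylinders : set (set (seqs a0)) :=
  [set C | exists n y, C = cyl n y].

(* A^infty with its Borel sigma-algebra (generated by the cylinders,
   which form a countable base of the product topology) *)
Definition Omega := g_sigma_algebraType cylinders.

Definition shift (x : Omega) : Omega := fun n => x n.+1.

Definition closed_set (X : set Omega) :=
  forall x : Omega, ~ X x -> exists n, forall y : Omega, cyl n x y -> ~ X y.

Definition is_shift_space (X : set Omega) :=
  X !=set0 /\ closed_set X /\ shift @` X `<=` X.

End Shift.

Section Measures.
Variables (R : realType) (A : finType) (a0 : A).
Local Notation Om := (Omega a0).
Local Notation Prob := (probability Om R).

(* real functions on A^infty continuous for the product topology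
   (A discrete): cylinders around x form a neighbourhood base of x *)
Definition continuous_fun (f : Om -> R) :=
  forall (x : Om) (e : R), 0 < e ->
    exists n, forall y : Om, @cyl A a0 n x y -> `|f y - f x| < e.

Definition invariant (mu : Prob) :=
  forall B : set Om, measurable B -> mu (@shift A a0 @^-1` B) = mu B.

Definition MS (X : set Om) : set Prob :=
  [set mu : Prob | invariant mu /\ mu X = 1%E].

Definition ergodic (mu : Prob) :=
  invariant mu /\
  forall B : set Om, measurable B -> @shift A a0 @^-1` B = B ->
    mu B = 0%E \/ mu B = 1%E.

Definition weak_nbhd (S : set Prob) (mu : Prob) (U : set Prob) :=
  exists (n : nat) (f : 'I_n -> Om -> R) (e : R),
    0 < e /\ (forall i, continuous_fun (f i)) /\
    [set nu : Prob | S nu /\ forall i : 'I_n,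
       (`| \int[nu]_x (f i x)%:E - \int[mu]_x (f i x)%:E | < e%:E)%E]
    `<=` U.

Definition is_mpartition (m : nat) (P : 'I_m -> set Om) :=
  (forall i, measurable (P i)) /\
  (forall i j, i != j -> P i `&` P j = set0) /\
  (forall x : Om, exists i, P i x).

Definition join_atom (m n : nat) (P : 'I_m -> set Om) (t : n.-tuple 'I_m) :
  set Om := [set x | forall i : 'I_n, P (tnth t i) (iter i (@shift A a0) x)].

Definition eta (p : R) : R := if p == 0 then 0 else - (p * ln p).

Definition Hjoin (mu : Prob) (m : nat) (P : 'I_m -> set Om) (n : nat) : R :=
  \sum_(t : n.-tuple 'I_m) eta (fine (mu (join_atom P t))).

Definition hpart (mu : Prob) (m : nat) (P : 'I_m -> set Om) : R :=
  limn (fun n : nat => Hjoin mu P n.+1 / n.+1%:R).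

Definition entropy (mu : Prob) : \bar R :=
  ereal_sup [set r | exists (m : nat) (P : 'I_m -> set Om),
                      is_mpartition P /\ r = (hpart mu P)%:E].

Definition entropy_dense (X : set Om) :=
  forall mu : Prob, MS X mu ->
  forall U : set Prob, weak_nbhd (MS X) mu U ->
  forall e : R, 0 < e ->
  exists nu : Prob,
    ergodic nu /\ MS X nu /\ U nu /\
    (`| entropy nu - entropy mu | < e%:E)%E.

Definition shift2 (xy : (Om * Om)%type) : (Om * Om)%type :=
  (@shift A a0 xy.1, @shift A a0 xy.2).

Definition coupling (mu nu : Prob) (lam : probability (Om * Om)%type R) :=
  (forall B : set Om, measurable B -> lam (B `*` setT) = mu B) /\
  (forall B : set Om, measurable B -> lam (setT `*` B) = nu B) /\
  (forall C : set (Om * Om)%type, measurable C ->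
     lam (shift2 @^-1` C) = lam C).

Definition d0 (xy : (Om * Om)%type) : R :=
  if xy.1 0%N == xy.2 0%N then 0 else 1.

Definition dbar (mu nu : Prob) : \bar R :=
  ereal_inf [set (\int[lam]_xy (d0 xy)%:E)%E | lam in coupling mu nu].

Definition dbarH (S T : set Prob) : \bar R :=
  maxe (ereal_sup [set ereal_inf [set dbar a b | b in T] | a in S])
       (ereal_sup [set ereal_inf [set dbar a b | a in S] | b in T]).

End Measures.

(* Main.v *)
(* Transfer an entropy-dense approximation from X_k to X along couplings.  Given mu on X,
   pick a coupled m on X_k, an ergodic nu on X_k close to m, and a coupled b on X.  Small
   mismatch of a shift-invariant coupling forces integrals of continuous functions and
   entropies to be close; only the ergodicity of b is missing.

   Ergodicity is restored by an extreme point.  The joinings of nu with measures on X form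
   a compact convex set; minimising the mismatch and then, lexicographically, the weights
   of all words, selects an extreme joining.  As nu is ergodic, conditioning a joining on an
   invariant set does not change its first marginal, so the extreme joining is ergodic, and
   its second marginal replaces b.

   For entropy, if X_i and Y_i differ with small probability, then the block X_0 ... X_(n-1)
   is a function of the Y-block and of the corrections (X_i where it differs from Y_i),
   whose entropy per symbol is small.  This gives both the continuity of entropy under
   couplings and the Kolmogorov-Sinai theorem for the coordinate partition. *)

(* The replacement for [b] has to stay coupled to [nu] with small mismatch, since weak* closeness
   alone does not control entropy. Hence the search takes place among joinings of [nu] rather than
   among ergodic measures on [X], and the mismatch is minimised before anything else: an arbitrary
   extreme joining could be far from the given coupling. A joining is encoded by its word weights
   over the alphabet of pairs, a point of a product of unit intervals. Consistency, invariance, the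
   first marginal and support over the closed set [X] become equations each involving finitely many
   weights, so the joinings form a closed set, compact by Tychonoff; Kolmogorov extension leads back
   to measures. Successive minimisation of affine functionals leaves faces, and the face left at the
   end is a single point because word weights separate measures. Conditioning on an invariant set of
   mass t gives an invariant first marginal m with t m <= nu, and an invariant probability dominated
   in this way by an ergodic one equals it. This is what keeps both pieces of a decomposed joining
   inside the convex set. *)
From HB Require Import structures.
From mathcomp Require Import all_boot all_order all_algebra.
From mathcomp Require Import all_classical all_reals all_analysis.
From mathcomp Require Import measurable_realfun.
From mathcomp Require Import ring lra zify.
Require Import Defs.
Import Order.TTheory GRing.Theory Num.Theory.
Import numFieldNormedType.Exports.
Set Implicit Arguments.
Unset Strict Implicit.
Unset Printing Implicit Defensive.
Local Open Scope classical_set_scope.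
Local Open Scope ring_scope.

(** * Cylinders *)

Section Cylinders.
Variables (A : finType) (a0 : A).
Local Notation Om := (Omega a0).
Local Notation cyl := (@cyl A a0).
Implicit Types (x y : Om) (w : seq A).

Lemma cyl_sym n x y : cyl n x y -> cyl n y x.
Proof. by move=> xy i /xy. Qed.

Lemma cyl_trans n x y z : cyl n x y -> cyl n y z -> cyl n x z.
Proof. by move=> xy yz i ni; rewrite yz// xy. Qed.

Lemma cyl_eq n x y : cyl n x y -> cyl n x = cyl n y.
Proof.
move=> xy; apply/seteqP; split => z; last exact: cyl_trans.
by apply: cyl_trans; exact: cyl_sym.
Qed.

Lemma cyl_le n m x : (n <= m)%N -> cyl m x `<=` cyl n x.
Proof. by move=> nm y xy i ni; apply: xy; exact: leq_trans nm. Qed.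

Lemma cyl0 x : cyl 0 x = setT.
Proof. by apply/seteqP; split. Qed.

(** Only the first n + 1 letters matter: they name the child of [cyl n x] whose letter n is [a]. *)
Definition subst_from n x (a : A) : Om := fun i => if (i < n)%N then x i else a.

Lemma cyl_subst_from n x a : cyl n x (subst_from n x a).
Proof. by move=> i ni; rewrite /subst_from ni. Qed.

Lemma cylS_subst_from n x y : cyl n x y -> cyl n.+1 (subst_from n x (y n)) y.
Proof.
move=> xy i; rewrite ltnS leq_eqVlt /subst_from => /predU1P[->|ni].
  by rewrite ltnn.
by rewrite ni xy.
Qed.

Definition word w : Om := fun i => nth a0 w i.

Definition cylw w : set Om := cyl (size w) (word w).

Lemma cylwP w x : cylw w x <-> mkseq x (size w) = w.
Proof.
split=> [wx|wx i iw]; last by rewrite /word -[in RHS]wx nth_mkseq.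
apply: (@eq_from_nth _ a0); rewrite size_mkseq// => i iw.
by rewrite nth_mkseq// wx.
Qed.

Lemma cyl_cylw n x : cyl n x = cylw (mkseq x n).
Proof.
rewrite /cylw size_mkseq; apply: cyl_eq => i ni.
by rewrite /word nth_mkseq.
Qed.

Lemma cylw_nil : cylw [::] = setT.
Proof. exact: cyl0. Qed.

Lemma cyl_mkseq n x y : cyl n x y <-> mkseq x n = mkseq y n.
Proof.
rewrite cyl_cylw cylwP size_mkseq; split => [->|->] //.
Qed.

(* Compactness of the sequence space, as bar induction on cylinders. *)
Lemma cyl_bar_ind (G : set Om -> Prop) :
  (forall n x, (forall a, G (cyl n.+1 (subst_from n x a))) -> G (cyl n x)) ->
  (forall x, exists n, G (cyl n x)) -> G setT.
Proof.
move=> Gstep Gbar; apply: contrapT => GT.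
(* As in König's lemma: a cylinder where [G] fails has a child where [G] fails. The choice is made
   total so that it can be iterated. *)
have step (nx : nat * Om) : {y : Om | ~ G (cyl nx.1 nx.2) ->
    cyl nx.1 nx.2 y /\ ~ G (cyl nx.1.+1 y)}.
  apply: cid; have [Gn|nGn] := pselect (G (cyl nx.1 nx.2)).
    by exists nx.2.
  apply: contrapT => /forallNP h; apply: nGn; apply: Gstep => a.
  apply: contrapT => nG; apply: (h (subst_from nx.1 nx.2 a)).
  by split=> //; exact: cyl_subst_from.
pose xs := fix xs n : Om := if n is k.+1 then sval (step (k, xs k)) else point.
have bad n : ~ G (cyl n (xs n)).
  elim: n => [|n IH]; first by rewrite cyl0.
  by have [] := svalP (step (n, xs n)) IH.
have xsS n : cyl n (xs n) (xs n.+1).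
  by have [] := svalP (step (n, xs n)) (bad n).
have xsD n k : cyl n (xs n) (xs (n + k)%N).
  elim: k => [|k IH]; first by rewrite addn0.
  rewrite addnS; apply: cyl_trans IH _.
  by apply: cyl_le (xsS _); rewrite leq_addr.
(* Letter i is final from stage i + 1 on, so this diagonal is the limit of the bad branch. *)
pose z : Om := fun i => xs i.+1 i.
have xz n : cyl n (xs n) z.
  move=> i ni; rewrite /z -(subnKC ni); symmetry; exact: xsD.
have [n] := Gbar z; rewrite -(cyl_eq (xz n)); exact: bad.
Qed.

Definition depends_on n (I : Type) (f : Om -> I) :=
  forall x y, cyl n x y -> f x = f y.

Lemma depends_le n m I (f : Om -> I) : (n <= m)%N ->
  depends_on n f -> depends_on m f.
Proof. by move=> nm nf x y /(cyl_le nm)/nf. Qed.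

Definition clopen : set (set Om) := [set S | exists n, depends_on n S].

Lemma clopen0 : clopen set0. Proof. by exists 0%N. Qed.

Lemma clopenC S : clopen S -> clopen (~` S).
Proof. by move=> [n Sn]; exists n => x y /Sn Sxy; rewrite /setC/= Sxy. Qed.

Lemma clopenU S T : clopen S -> clopen T -> clopen (S `|` T).
Proof.
move=> [n Sn] [m Tm]; exists (maxn n m) => x y xy; rewrite /setU/=.
by rewrite (depends_le (leq_maxl _ m) Sn xy) (depends_le (leq_maxr n _) Tm xy).
Qed.

Lemma clopen_cyl n x : clopen (cyl n x).
Proof.
exists n => y z yz; apply/propext; split => [xy|xz].
  exact: cyl_trans xy yz.
exact: cyl_trans xz (cyl_sym yz).
Qed.

Definition open_set (U : set Om) := forall x, U x -> exists n, cyl n x `<=` U.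

Lemma clopen_open S : clopen S -> open_set S.
Proof. by move=> [n Sn] x Sx; exists n => y /Sn <-. Qed.

Lemma measurable_cyl n x : measurable (cyl n x : set Om).
Proof. by apply: sub_sigma_algebra; exists n, x. Qed.

Lemma measurable_cylw w : measurable (cylw w).
Proof. exact: measurable_cyl. Qed.

Lemma measurable_open U : open_set U -> measurable U.
Proof.
move=> Uo.
(* Indexing by words instead of points makes the union countable. *)
pose F w := if `[< cylw w `<=` U >] then cylw w else set0.
have -> : U = \bigcup_w F w.
  apply/seteqP; split => [x Ux|x [w _]]; last first.
    by rewrite /F; case: asboolP => // wU; exact: wU.
  have [n nU] := Uo _ Ux; rewrite cyl_cylw in nU.
  by exists (mkseq x n) => //; rewrite /F; case: asboolP => // _; rewrite -cyl_cylw.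
apply: countable_bigcupT_measurable => [|w]; first exact: countableP.
by rewrite /F; case: asboolP => // _; exact: measurable_cylw.
Qed.

Lemma measurable_clopen S : clopen S -> measurable S.
Proof. by move=> /clopen_open/measurable_open. Qed.

Lemma closed_measurable (X : set Om) : closed_set X -> measurable X.
Proof.
move=> Xc; rewrite -[X]setCK; apply: measurableC; apply: measurable_open => x.
by move=> /Xc[n nX]; exists n => y /nX.
Qed.

Lemma measurable_depends n (I : Type) (f : Om -> I) (i : set I) :
  depends_on n f -> measurable (f @^-1` i).
Proof.
move=> nf; apply: measurable_clopen; exists n => x y xy.
by rewrite /preimage/= (nf _ _ xy).
Qed.

Lemma measurable_coord i (a : A) : measurable [set x : Om | x i = a].
Proof.
apply: (@measurable_depends i.+1 A (fun x => x i) [set a]) => x y xy.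
by rewrite xy.
Qed.

Lemma measurable_to_seq d (T : measurableType d) (g : T -> Om) :
  (forall i a, measurable [set t | g t i = a]) -> measurable_fun setT g.
Proof.
move=> mg; apply: (@measurability _ _ T Om setT g (@cylinders A a0 : set (set Om)) erefl).
move=> _ [_ [n [y ->]] <-]; rewrite setTI.
have -> : g @^-1` cyl n y = \bigcap_(i in `I_n) [set t | g t i = y i].
  by apply/seteqP; split => t /= h i; exact: h.
apply: fin_bigcap_measurable => // i _; exact: mg.
Qed.

Lemma measurable_shift : measurable_fun setT (@shift A a0).
Proof. by apply: measurable_to_seq => i a; exact: (measurable_coord i.+1). Qed.

Lemma iter_shiftE i x k : iter i (@shift A a0) x k = x (i + k)%N.
Proof. by elim: i x k => //= i IH x k; rewrite /shift IH addnS. Qed.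

Lemma measurable_iter_shift i : measurable_fun setT (iter i (@shift A a0)).
Proof.
apply: measurable_to_seq => k a.
rewrite (_ : [set t | _] = [set t : Om | t (i + k)%N = a]).
  exact: measurable_coord.
by apply/seteqP; split => t /=; rewrite iter_shiftE.
Qed.

Lemma measurable_continuous_fun (R : realType) (f : Om -> R) :
  continuous_fun f -> measurable_fun setT f.
Proof.
move=> cf; apply: (measurability _ (RGenOInfty.measurableE R)) => //.
move=> _ [_ [a ->] <-]; rewrite setTI; apply: measurable_open => x /=.
rewrite in_itv/= andbT => ax.
have [n nf] := cf x (f x - a) ltac:(by rewrite subr_gt0).
exists n => y /nf; rewrite /= in_itv/= andbT ltr_norml => /andP[h _].
by lra.
Qed.

(** Heine's theorem by bar induction: [G S] says that one modulus serves all of [S]. *)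
Lemma continuous_fun_unif (R : realType) (f : Om -> R) (e : R) : 0 < e ->
  continuous_fun f -> exists n, forall x y, cyl n x y -> `|f x - f y| < e.
Proof.
move=> e0 cf.
pose G (S : set Om) := exists n, forall x y, S x -> S y -> cyl n x y -> `|f x - f y| < e.
suff: G setT by move=> [n nG]; exists n => x y; exact: nG.
apply: cyl_bar_ind => [n x h|x].
  (* Agreement on n + 1 letters puts both points in the same child, whose own modulus then
     applies. *)
  have /choice[N hN] := h; exists (maxn n.+1 (\max_a N a)) => u v xu xv uv.
  apply: (hN (u n)).
  - exact: cylS_subst_from.
  - apply: cyl_trans (cylS_subst_from xu) _.
    by apply: cyl_le uv; exact: leq_maxl.
  - apply: cyl_le uv; rewrite leq_max; apply/orP; right.
    exact: (leq_bigmax (u n)).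
have [|n nf] := cf x (e / 2); first by rewrite divr_gt0.
exists n, 0%N => u v /nf xu /nf xv _.
move: xu xv; rewrite !ltr_norml => /andP[? ?] /andP[? ?].
by apply/andP; split; lra.
Qed.

End Cylinders.

(** * Measures on sequence spaces *)

Section ProbabilityConstructions.
Local Open Scope ereal_scope.
Context d (T : measurableType d) (R : realType).

Lemma probability_of_measure (mu : {measure set T -> \bar R}) :
  mu setT = 1 -> exists P : probability T R, forall S, P S = mu S.
Proof.
move=> mu1; exists (mnormalize mu (dirac point)) => S.
by rewrite /= /mnormalize mu1 onee_eq0/= invr1 mule1.
Qed.

Lemma probability_of_pushforward d' (T' : measurableType d')
    (P : probability T R) (f : T -> T') : measurable_fun setT f ->
  exists Q : probability T' R, forall S, Q S = P (f @^-1` S).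
Proof.
move=> mf; pose F := mfun_Sub (mem_set mf).
by exists (distribution P F).
Qed.

Lemma probability_cond (P : probability T R) (B : set T) :
  measurable B -> P B != 0 ->
  exists Q : probability T R, forall S,
    Q S = P (S `&` B) * (fine (P B))^-1%:E.
Proof.
move=> mB PB0; exists (mnormalize (mrestr P mB) P) => S.
have PBoo : P B != +oo.
  by rewrite -ltey (le_lt_trans (probability_le1 _ _))// ltry.
have e : (mrestr P mB : {measure set T -> \bar R}) setT = P B.
  by rewrite /= /mrestr setTI.
by rewrite [LHS]/= /mnormalize e (negbTE PB0) (negbTE PBoo).
Qed.

End ProbabilityConstructions.

(** * Kolmogorov extension from consistent word weights *)

Definition clopen_algebra (A : finType) (a0 : A) : Type := seqs a0.

HB.instance Definition _ (A : finType) (a0 : A) :=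
  Pointed.on (clopen_algebra a0).
(** The algebra of clopen sets lives on a copy of the sequence space, because [Omega] already
    carries the Borel sigma-algebra. The Carathéodory extension starts from this algebra. *)
HB.instance Definition _ (A : finType) (a0 : A) :=
  @isAlgebraOfSets.Build default_measure_display (clopen_algebra a0)
    (@clopen A a0) (@clopen0 A a0) (@clopenU A a0) (@clopenC A a0).

Section KolmogorovExtension.
Variables (R : realType) (A : finType) (a0 : A).
Local Notation Om := (Omega a0).
Local Notation cyl := (@cyl A a0).
Local Notation cylw := (@cylw A a0).
Local Notation word := (@word A a0).
Local Notation clopen := (@clopen A a0).
Variable q : seq A -> R.
Hypotheses (q_ge0 : forall w, 0 <= q w) (q_nil : q [::] = 1)
  (q_rcons : forall w, q w = \sum_a q (rcons w a)).

(* The mass of S inside the cylinder of w, computed n letters further down. *)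
Fixpoint qmass n (S : set Om) w : R :=
  if n is k.+1 then \sum_a qmass k S (rcons w a)
  else if `[< S (word w) >] then q w else 0.

Lemma qmass_ge0 n S w : 0 <= qmass n S w.
Proof.
elim: n w => [|n IH] w /=; first by case: asboolP.
by apply: sumr_ge0 => a _.
Qed.

Lemma qmass0 n w : qmass n set0 w = 0.
Proof.
elim: n w => [|n IH] w /=; first by case: asboolP.
by apply: big1 => a _.
Qed.

Lemma qmassU n S S' w : S `&` S' = set0 ->
  qmass n (S `|` S') w = qmass n S w + qmass n S' w.
Proof.
move=> SS'; elim: n w => [|n IH] w /=; last first.
  by rewrite -big_split/=; apply: eq_bigr => a _.
case: (asboolP (S (word w))) => Sw; last first.
  rewrite add0r; congr (if _ then _ else _); apply: asbool_equiv_eq.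
  by split => [[]//|?]; right.
rewrite (asboolT (or_introl Sw : (S `|` S') (word w))).
case: asboolP => [S'w|_]; last by rewrite addr0.
by have : (S `&` S') (word w) by []; rewrite SS'.
Qed.

Lemma word_rcons w a : cyl (size w) (word w) (word (rcons w a)).
Proof. by move=> i iw; rewrite /word nth_rcons iw. Qed.

(** Once [S] is decided, one more letter only splits each weight among the children, which [q_rcons]
    sums back. So the mass does not depend on the depth used. *)
Lemma qmassS n S w : depends_on (size w + n) S -> qmass n.+1 S w = qmass n S w.
Proof.
elim: n w => [|n IH] w Sn.
  rewrite addn0 in Sn; rewrite /= [in RHS]q_rcons.
  case: asboolP => Sw; last first.
    by apply: big1 => a _; rewrite asboolF// -(Sn _ _ (@word_rcons w a)).
  by apply: eq_bigr => a _; rewrite asboolT// -(Sn _ _ (@word_rcons w a)).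
rewrite [LHS]/= [RHS]/=; apply: eq_bigr => a _; apply: IH.
by rewrite size_rcons addSnnS.
Qed.

Lemma qmass_sub n S w : cylw w `<=` S -> qmass n S w = q w.
Proof.
elim: n w => [|n IH] w wS /=; first by rewrite asboolT//; apply: wS.
rewrite [RHS]q_rcons; apply: eq_bigr => a _; apply: IH.
apply: subset_trans wS => x /=; rewrite /cylw size_rcons => wx.
by apply: cyl_trans (@word_rcons w a) _; exact: cyl_le wx.
Qed.

Lemma qmass_disj n S w : cylw w `&` S = set0 -> qmass n S w = 0.
Proof.
(* Both [cylw w] and its union with [S] have mass [q w], so additivity leaves 0 for [S]. *)
move=> wS; have := qmassU n w wS; rewrite (@qmass_sub _ (cylw w))//.
rewrite (@qmass_sub _ (cylw w `|` S)); last by move=> x; left.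
by move/eqP; rewrite -[X in X == _]addr0 => /eqP/addrI.
Qed.

Lemma qmass_cylw v w : qmass (size v) (cylw (w ++ v)) w = q (w ++ v).
Proof.
elim: v w => [|b v IH] w; first by rewrite cats0 qmass_sub.
rewrite /= (bigD1 b)//= -cat_rcons IH big1 ?addr0// => a ab.
apply: qmass_disj; apply/seteqP; split => // x []; rewrite cat_rcons.
move=> /(_ (size w)); rewrite size_rcons ltnSn => /(_ isT) xa.
move=> /(_ (size w)); rewrite size_cat/= addnS ltnS leq_addr => /(_ isT).
rewrite xa /word nth_rcons ltnn eqxx nth_cat ltnn subnn/= => /eqP.
by rewrite (negbTE ab).
Qed.

Definition depth (S : set Om) : nat := xget 0%N [set n | depends_on n S].

Definition premeasure (S : set (clopen_algebra a0)) : \bar R :=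
  (qmass (depth S) S [::])%:E.

Lemma qmassE n k S : depends_on n S -> qmass (n + k) S [::] = qmass n S [::].
Proof.
move=> Sn; elim: k => [|k IH]; first by rewrite addn0.
by rewrite addnS qmassS// add0n; apply: depends_le Sn; exact: leq_addr.
Qed.

Lemma premeasureE n S : depends_on n S -> premeasure S = (qmass n S [::])%:E.
Proof.
move=> Sn; congr EFin.
have Sd : depends_on (depth S) S.
  by apply: (@xgetPex _ _ [set n | depends_on n S]); exists n.
by rewrite -(qmassE n Sd) addnC qmassE.
Qed.

Lemma premeasure0 : premeasure set0 = 0%E.
Proof. by rewrite /premeasure qmass0. Qed.

Lemma premeasure_ge0 S : (0 <= premeasure S)%E.
Proof. by rewrite lee_fin qmass_ge0. Qed.

Lemma premeasureU (S S' : set Om) : clopen S -> clopen S' -> S `&` S' = set0 ->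
  premeasure (S `|` S') = (premeasure S + premeasure S')%E.
Proof.
move=> [n Sn] [m Sm] SS'.
have Sn' := depends_le (leq_maxl n m) Sn.
have Sm' := depends_le (leq_maxr n m) Sm.
rewrite (premeasureE Sn') (premeasureE Sm') (@premeasureE (maxn n m)).
  by rewrite qmassU.
by move=> x y xy; rewrite /setU/= (Sn' _ _ xy) (Sm' _ _ xy).
Qed.

Lemma clopen_bigsetU (F : nat -> set Om) n : (forall i, clopen (F i)) ->
  clopen (\bigcup_(i < n) F i).
Proof.
move=> cF; rewrite bigcup_mkord; apply: (big_ind clopen) => //; first exact: clopen0.
exact: clopenU.
Qed.

(** By compactness a clopen set that is a countable disjoint union of clopen sets has only finitely
    many nonempty pieces, so finite additivity suffices. *)
Lemma premeasure_sigma_additive : semi_sigma_additive premeasure.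
Proof.
move=> F cF tF cU.
have [N UN] : exists N, \bigcup_i F i `<=` \bigcup_(i < N) F i.
  pose G (S : set Om) := exists N,
    S `&` \bigcup_i F i `<=` \bigcup_(i < N) F i.
  suff : G setT by move=> [N]; rewrite setTI; exists N.
  apply: cyl_bar_ind => [n x h|x].
    have /choice[N hN] := h; exists (\max_a N a)%N => y [xy Uy].
    have := hN (y n) y (conj (cylS_subst_from xy) Uy).
    move=> -[i /= iN Fiy]; exists i => //=.
    by apply: leq_trans iN _; exact: (leq_bigmax (y n)).
  have [[i _ Fix]|Ux] := pselect ((\bigcup_i F i) x).
    have [n nF] := clopen_open (cF i) Fix.
    exists n, i.+1 => y [xy _]; exists i => //=.
    exact: nF.
  have [n nF] := clopen_open (clopenC cU) Ux.
  by exists n, 0%N => y [/nF].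
have F0 i : (N <= i)%N -> F i = set0.
  move=> Ni; apply/seteqP; split => // x Fix.
  have : (\bigcup_i F i) x by exists i.
  move/UN => -[j /= jN Fjx].
  move/trivIsetP : tF => /(_ i j Logic.I Logic.I); rewrite neq_ltn.
  rewrite (leq_trans jN Ni) orbT => /(_ isT) Fij.
  by have : (F i `&` F j) x by []; rewrite Fij.
have sumE n : (\sum_(0 <= i < n) premeasure (F i) =
    premeasure (\bigcup_(i < n) F i))%E.
  elim: n => [|n IH]; first by rewrite big_geq// bigcup_mkord big_ord0 premeasure0.
  have -> : \bigcup_(i < n.+1) F i = \bigcup_(i < n) F i `|` F n.
    by rewrite !bigcup_mkord big_ord_recr.
  rewrite big_nat_recr//= IH premeasureU//; first exact: clopen_bigsetU.
    exact: cF.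
  apply/seteqP; split => // x [[j /= jn Fjx] Fnx].
  move/trivIsetP : tF => /(_ n j Logic.I Logic.I); rewrite neq_ltn jn orbT.
  move=> /(_ isT) Fnj.
  by have : (F n `&` F j) x by []; rewrite Fnj.
apply: cvg_near_cst; exists N => // n /= Nn; rewrite sumE; congr premeasure.
apply/seteqP; split => x; first by case=> i _; exists i.
move/UN => -[i /= iN]; exists i => //=.
exact: leq_trans iN Nn.
Qed.

HB.instance Definition _ := isMeasure.Build _ (clopen_algebra a0) R premeasure
  premeasure0 premeasure_ge0 premeasure_sigma_additive.

Theorem kolmogorov_extension : exists P : probability Om R,
  forall w, P (cylw w) = (q w)%:E.
Proof.
pose mu := measure_extension premeasure.
(* The extension lives on the sigma-algebra generated by the clopen sets; it contains the cylinders,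
   so the identity carries the measure over to [Om]. *)
have idm : measurable_fun setT
    (id : g_sigma_algebraType (@measurable _ (clopen_algebra a0)) -> Om).
  apply: (@measurability _ _ _ _ setT _ (@cylinders A a0 : set (set Om)) erefl).
  move=> _ [_ [n [y ->]] <-]; rewrite setTI preimage_id.
  by apply: sub_sigma_algebra; exact: clopen_cyl.
have muw w : mu (cylw w) = (q w)%:E.
  have cw : depends_on (size w) (cylw w).
    move=> x y xy; apply/propext; split => [wx|wy]; first exact: cyl_trans wx xy.
    exact: cyl_trans wy (cyl_sym xy).
  rewrite /mu /measure_extension measurable_mu_extE/=; last by exists (size w).
  by rewrite (premeasureE cw) (qmass_cylw w [::]).
have [|P' P'E] := @probability_of_measure _ _ _ mu.
  by have := muw [::]; rewrite cylw_nil q_nil.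
have [P PE] := probability_of_pushforward P' idm.
by exists P => w; rewrite PE; exact: etrans (P'E _) (muw w).
Qed.

End KolmogorovExtension.

(** * Real-valued probabilities and finite-valued labels *)

Definition pr d (T : measurableType d) (R : realType) (P : probability T R)
  (S : set T) : R := fine (P S).

Section RealProbability.
Context d (T : measurableType d) (R : realType) (P : probability T R).
Implicit Types S : set T.

Lemma prE S : measurable S -> P S = (pr P S)%:E.
Proof. by move=> mS; rewrite /pr fineK// fin_num_measure. Qed.

Lemma pr_ge0 S : 0 <= pr P S.
Proof. exact: fine_ge0. Qed.

Lemma pr_setT : pr P setT = 1.
Proof. by rewrite /pr probability_setT. Qed.

Lemma pr_set0 : pr P set0 = 0.
Proof. by rewrite /pr measure0. Qed.

Lemma pr_le1 S : measurable S -> pr P S <= 1.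
Proof. by move=> mS; rewrite -lee_fin -prE// probability_le1. Qed.

Lemma pr_mono S S' : measurable S -> measurable S' -> S `<=` S' ->
  pr P S <= pr P S'.
Proof.
by move=> mS mS' SS'; rewrite -lee_fin -!prE//; apply: le_measure; rewrite ?inE.
Qed.

Lemma prU S S' : measurable S -> measurable S' -> S `&` S' = set0 ->
  pr P (S `|` S') = pr P S + pr P S'.
Proof.
move=> mS mS' SS'; apply: EFin_inj; rewrite EFinD -!prE//; last exact: measurableU.
exact: measureU.
Qed.

Lemma pr_setU_le S S' : measurable S -> measurable S' ->
  pr P (S `|` S') <= pr P S + pr P S'.
Proof.
move=> mS mS'; rewrite -lee_fin EFinD -!prE//; last exact: measurableU.
exact: measureU2.
Qed.

Lemma prC S : measurable S -> pr P (~` S) = 1 - pr P S.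
Proof.
move=> mS; rewrite -pr_setT -(setUv S) prU//; last 2 first.
  exact: measurableC.
  by rewrite setICr.
by rewrite addrAC subrr add0r.
Qed.

(** A finite-valued random variable, that is, a finite measurable partition whose cells are named by
    [I]. *)
Definition mlabel (I : finType) (f : T -> I) :=
  forall i, measurable (f @^-1` [set i]).

Lemma mlabel_preimage (I : finType) (f : T -> I) (B : set I) :
  mlabel f -> measurable (f @^-1` B).
Proof.
move=> mf; have -> : f @^-1` B = \bigcup_(i in B) f @^-1` [set i].
  by apply/seteqP; split => [x Bx|x [i Bi /= ->]//]; exists (f x).
by apply: fin_bigcup_measurable => //; exact: finite_finset.
Qed.

Lemma mlabel_comp (I J : finType) (f : T -> I) (phi : I -> J) :
  mlabel f -> mlabel (phi \o f).
Proof. by move=> mf j; rewrite comp_preimage; exact: mlabel_preimage. Qed.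

Lemma mlabel_pair (I J : finType) (f : T -> I) (g : T -> J) :
  mlabel f -> mlabel g -> mlabel (fun x => (f x, g x)).
Proof.
move=> mf mg [i j]; rewrite (_ : _ @^-1` _ = f @^-1` [set i] `&` g @^-1` [set j]).
  exact: measurableI.
by apply/seteqP; split => x /= [-> ->].
Qed.

Lemma pr_label (I : finType) (f : T -> I) S : mlabel f -> measurable S ->
  pr P S = \sum_i pr P (S `&` f @^-1` [set i]).
Proof.
move=> mf mS.
suff H (s : seq I) : uniq s ->
    \sum_(i <- s) pr P (S `&` f @^-1` [set i]) =
    pr P (S `&` f @^-1` [set i | i \in s]).
  rewrite H ?index_enum_uniq//; congr (pr P _).
  by apply/seteqP; split => [x Sx|x []//]; split => //=; rewrite mem_index_enum.
elim: s => [_|i s IH /= /andP[is_ us]].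
  rewrite big_nil (_ : _ `&` _ = set0) ?pr_set0//.
  by apply/seteqP; split => x // [].
rewrite big_cons IH// -prU//.
- congr (pr P _); apply/seteqP; split => x /=.
    by move=> [[Sx fx]|[Sx fx]]; split => //; rewrite inE fx ?eqxx ?orbT.
  move=> [Sx]; rewrite inE => /orP[/eqP fx|fx]; by [left|right].
- exact: measurableI.
- by apply: measurableI => //; exact: mlabel_preimage.
- apply/seteqP; split => x //= [[_ ->] [_]].
  by rewrite (negbTE is_).
Qed.

Lemma pr_labelT (I : finType) (f : T -> I) : mlabel f ->
  \sum_i pr P (f @^-1` [set i]) = 1.
Proof.
move=> mf; rewrite -pr_setT (pr_label mf measurableT).
by apply: eq_bigr => i _; rewrite setTI.
Qed.

End RealProbability.

(** * Rigidity of ergodic measures under domination *)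

Section HahnReal.
Context d (T : measurableType d) (R : realType).
Local Open Scope ereal_scope.

(** Jordan decomposition of the signed measure m - n, with [N] the negative set of a Hahn
    decomposition. *)
Lemma hahn_probability (m n : probability T R) :
  exists (Jp Jn : {finite_measure set T -> \bar R}) (N : set T),
  [/\ measurable N, Jp N = 0, Jn (~` N) = 0 &
    forall S, measurable S -> m S - n S = Jp S - Jn S].
Proof.
pose k := cadd (charge_of_finite_measure m)
  (cscale (-1) (charge_of_finite_measure n)).
have [P [N PN]] := Hahn_decomposition k.
have [[mP _] [mN _] PNT PN0] := PN.
have pos0 : jordan_pos PN N = 0.
  rewrite jordan_posE cjordan_posE /crestr0 mem_set// /crestr.
  by rewrite setIC PN0 charge0.
have neg0 : jordan_neg PN (~` N) = 0.
  rewrite jordan_negE cjordan_negE /crestr0 mem_set; last exact: measurableC.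
  by rewrite /crestr setICl charge0 oppe0.
exists (jordan_pos PN), (jordan_neg PN), N; split => // S mS.
apply: (etrans _ (etrans (jordan_decomp PN mS) _)).
  by rewrite /k /= /cadd/= /cscale/= mulN1e.
by rewrite /cadd /= /cscale mulN1e.
Qed.

End HahnReal.

Section ErgodicExtremal.
Variables (R : realType) (A : finType) (a0 : A).
Local Notation Om := (Omega a0).
Local Notation Prob := (probability Om R).
Local Notation sh := (@shift A a0).

Lemma measurable_sh_preimage (S : set Om) : measurable S ->
  measurable (sh @^-1` S).
Proof. by move=> mS; rewrite -[X in measurable X]setTI; exact: measurable_shift. Qed.

Lemma measurable_ish_preimage i (S : set Om) : measurable S ->
  measurable (iter i sh @^-1` S).
Proof.
by move=> mS; rewrite -[X in measurable X]setTI; exact: measurable_iter_shift.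
Qed.

Lemma invariant_iter (mu : Prob) i (S : set Om) : invariant mu -> measurable S ->
  mu (iter i sh @^-1` S) = mu S.
Proof.
move=> imu mS; elim: i => //= i IH.
rewrite -[RHS]IH -[RHS]imu; last exact: measurable_ish_preimage.
by congr (mu _); apply/seteqP; split => x; rewrite /preimage/= -iterSr.
Qed.

(* The Hahn negative set of m - n and its preimages under the shift all minimise
   m - n; so does their limsup, which is strictly invariant. *)
Lemma ergodic_extremal (m n : Prob) (t : R) : 0 < t ->
  ergodic n -> invariant m ->
  (forall S, measurable S -> t * pr m S <= pr n S) ->
  forall S, measurable S -> m S = n S.
Proof.
move=> t0 [inn en] im mn.
have [Jp [Jn [N [mN JpN JnN dec]]]] := hahn_probability m n.
pose E i := iter i sh @^-1` N.
have mE i : measurable (E i) by exact: measurable_ish_preimage.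
have fJp S : measurable S -> Jp S = (fine (Jp S))%:E.
  by move=> mS; rewrite fineK// fin_num_measure.
have fJn S : measurable S -> Jn S = (fine (Jn S))%:E.
  by move=> mS; rewrite fineK// fin_num_measure.
have decr S : measurable S -> pr m S - pr n S = fine (Jp S) - fine (Jn S).
  by move=> mS; have := dec _ mS; rewrite !prE// fJp// fJn// -!EFinB => -[].
have JpTC S : measurable S -> fine (Jp setT) = fine (Jp S) + fine (Jp (~` S)).
  move=> mS; apply: EFin_inj; rewrite EFinD -!fJp//; last exact: measurableC.
  by rewrite -(setUv S) measureU ?setICr//; exact: measurableC.
have JnTC S : measurable S -> fine (Jn setT) = fine (Jn S) + fine (Jn (~` S)).
  move=> mS; apply: EFin_inj; rewrite EFinD -!fJn//; last exact: measurableC.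
  by rewrite -(setUv S) measureU ?setICr//; exact: measurableC.
(* By invariance m - n has on [E i] the value it has on [N], namely its minimum; this forces [Jp] to
   vanish on [E i] and [Jn] off it. *)
have JE i : fine (Jp (E i)) = 0 /\ fine (Jn (~` E i)) = 0.
  have : pr m (E i) - pr n (E i) = pr m N - pr n N.
    by rewrite /pr !invariant_iter.
  rewrite !decr// JpN.
  have := JnTC _ mN; rewrite JnN; have := JnTC _ (mE i).
  have : 0 <= fine (Jp (E i)) by exact: fine_ge0.
  have : 0 <= fine (Jn (~` E i)) by exact: fine_ge0.
  rewrite /=; lra.
pose L := \bigcap_k \bigcup_(i in [set i | (k <= i)%N]) E i.
have mL : measurable L.
  by apply: bigcap_measurable => // k _; exact: bigcup_measurable.
have JpL : fine (Jp L) = 0.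
  have: (Jp L <= \sum_(i <oo) Jp (E i))%E.
    apply: measure_sigma_subadditive => // x /(_ 0%N Logic.I)[i _ Ei].
    by exists i.
  rewrite eseries0; last by move=> i _ _; rewrite fJp// (JE i).1.
  by rewrite {1}fJp// lee_fin => h; apply/eqP; rewrite eq_le h fine_ge0.
have JnL : fine (Jn (~` L)) = 0.
  have mCL : measurable (~` L) by exact: measurableC.
  have: (Jn (~` L) <= \sum_(i <oo) Jn (~` E i))%E.
    apply: measure_sigma_subadditive => // [i|x]; first exact: measurableC.
    rewrite /L setC_bigcap => -[k _]; rewrite /setC/= => h.
    by exists k => //= Ek; apply: h; exists k => //=.
  rewrite eseries0; last by move=> i _ _; rewrite fJn ?(JE i).2//; exact: measurableC.
  by rewrite {1}fJn// lee_fin => h; apply/eqP; rewrite eq_le h fine_ge0.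
have iL : sh @^-1` L = L.
  apply/seteqP; split => x Lx k _.
    have [i /= ki Ei] := Lx k Logic.I.
    exists i.+1 => /=; first exact: leqW.
    by rewrite /E /preimage/= -iterS iterSr.
  have [[//|i] /= ki Ei] := Lx k.+1 Logic.I.
  by exists i => //; move: Ei; rewrite /E /preimage/= -iterS iterSr.
have mn0 S : measurable S -> pr n S = 0 -> pr m S = 0.
  move=> mS nS; have := mn _ mS; rewrite nS => h.
  by apply/eqP; rewrite eq_le pr_ge0 andbT -(pmulr_rle0 _ t0).
(* Ergodicity gives [L] measure 0 or 1 under [n], and domination passes null sets on to [m]. *)
have kL : pr m L = pr n L.
  have [nL|nL] := en _ mL iL.
    by rewrite (mn0 _ mL) /pr nL.
  have nCL : pr n (~` L) = 0 by rewrite prC// /pr nL subrr.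
  have := mn0 _ (measurableC mL) nCL; rewrite prC// => /eqP.
  by rewrite subr_eq0 => /eqP <-; rewrite /pr nL.
(* [L] carries all of [Jn] and none of [Jp], so equality on [L] kills [Jn]; equal total masses then
   kill [Jp]. *)
have T0 : fine (Jp setT) = 0 /\ fine (Jn setT) = 0.
  have := decr _ mL; have := decr _ measurableT; rewrite !pr_setT kL !subrr.
  by have := JnTC _ mL; rewrite JnL JpL; lra.
move=> S mS; rewrite !prE//; congr EFin; apply/eqP; rewrite -subr_eq0 decr//.
have := JnTC _ mS; have := JpTC _ mS; rewrite T0.1 T0.2.
have : 0 <= fine (Jp S) by exact: fine_ge0.
have : 0 <= fine (Jn S) by exact: fine_ge0.
have : 0 <= fine (Jp (~` S)) by exact: fine_ge0.
have : 0 <= fine (Jn (~` S)) by exact: fine_ge0.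
by move=> *; apply/eqP; lra.
Qed.

Lemma probability_cylw_unique (m n : Prob) :
  (forall w, m (@cylw A a0 w) = n (@cylw A a0 w)) ->
  forall S, measurable S -> m S = n S.
Proof.
move=> mn S mS.
(* Two cylinders are nested or disjoint, so adding the empty set gives a pi-system. *)
pose G : set (set Om) := [set S | S = set0 \/ exists w, S = @cylw A a0 w].
apply: (@measure_unique _ _ _ G (fun=> setT)) => //.
- apply/seteqP; split.
    apply: smallest_sub; first exact: smallest_sigma_algebra.
    move=> _ [k [y ->]]; apply: sub_sigma_algebra; right.
    by exists (mkseq y k); exact: cyl_cylw.
  apply: smallest_sub => //; first exact: sigma_algebra_measurable.
  move=> _ [->|[w ->]] //; exact: measurable_cylw.
- move=> S1 S2 [->|[w1 ->]]; first by rewrite set0I; left.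
  move=> [->|[w2 ->]]; first by rewrite setI0; left.
  wlog ww : w1 w2 / (size w1 <= size w2)%N.
    move=> wl; have [|/ltnW] := leqP (size w1) (size w2); first exact: wl.
    by rewrite setIC; exact: wl.
  have [w12|w12] := pselect (@cyl A a0 (size w1) (@word A a0 w1) (@word A a0 w2)).
    right; exists w2; apply/setIidPr => x /(cyl_le ww) w2x.
    exact: cyl_trans w12 w2x.
  left; apply/seteqP; split => // x [w1x /(cyl_le ww)/cyl_sym w2x].
  by apply: w12; exact: cyl_trans w1x w2x.
- by move=> _; right; exists [::]; rewrite cylw_nil.
- by rewrite bigcup_const//; exists 0%N.
- by move=> _ [->|[w ->]]; [rewrite !measure0|exact: mn].
- by move=> _; rewrite /= probability_setT ltry.
Qed.

End ErgodicExtremal.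

(** * Ergodic joinings *)

Section LexicographicMinimum.
Variables (R : realType) (T : topologicalType).
Implicit Types (K : set T) (g : T -> R).

Definition argmin g K := [set q | K q /\ forall q', K q' -> g q <= g q'].

Lemma closed_argmin g K : continuous g -> closed K -> closed (argmin g K).
Proof.
move=> cg cK.
have -> : argmin g K = K `&` \bigcap_(q' in K) (g @^-1` [set x | x <= g q']).
  by apply/seteqP; split => q [Kq h]; split.
apply: closedI => //; apply: closed_bigI => q' _.
by apply: closed_comp => // ? _; exact: cg.
Qed.

Lemma argmin_neq0 g K : continuous g -> compact K -> K !=set0 ->
  argmin g K !=set0.
Proof.
move=> cg cK K0.
have [|c Kc cmin] := @compact_EVT_min _ _ g K K0 cK.
  exact: continuous_subspaceT.
exists c; split; first exact: set_mem.
by move=> q' Kq'; apply: cmin; exact: mem_set.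
Qed.

(** If a proper convex combination minimises [g n], so do both of its end points. Hence end points
    in [K] follow [q] into every successive set of minimisers and share all its values. *)
Lemma lex_min_extreme K (g : nat -> T -> R) : (forall n, continuous (g n)) ->
  compact K -> closed K -> K !=set0 ->
  exists q, [/\ K q, forall q', K q' -> g 0%N q <= g 0%N q' &
    forall q1 q2 t, K q1 -> K q2 -> 0 < t < 1 ->
      (forall n, g n q = t * g n q1 + (1 - t) * g n q2) ->
      forall n, g n q1 = g n q].
Proof.
move=> cg cK clK K0.
(* [Ks n] has been minimised for the functionals of index below n. A cluster point of a choice of
   elements lies in all these nested closed sets. *)
pose Ks := fix Ks n := if n is k.+1 then argmin (g k) (Ks k) else K.
have KsS n : Ks n.+1 `<=` Ks n by move=> q [].
have Ksle n k : Ks (n + k)%N `<=` Ks n.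
  by elim: k => [|k IH]; rewrite ?addn0// addnS => q /KsS/IH.
have KsK n : Ks n `<=` K by have := Ksle 0%N n; rewrite add0n.
have Ksc n : closed (Ks n) by elim: n => //= n IH; exact: closed_argmin.
have Ks0 n : Ks n !=set0.
  elim: n => //= n IH; apply: argmin_neq0 => //.
  by apply: subclosed_compact cK _; [exact: Ksc|exact: KsK].
have /choice[x xK] : forall n, exists x, Ks n x by move=> n; exact: Ks0.
have xF n : (x @ \oo) (Ks n).
  exists n => // k /= nk; apply: (Ksle n (k - n)%N).
  by rewrite subnKC//; exact: xK.
have [q [Kq clq]] := cK (x @ \oo) _ (xF 0%N).
have qK n : Ks n q.
  by apply: (Ksc n) => B; exact: clq (xF n).
exists q; split => [//|q' Kq'|q1 q2 t Kq1 Kq2 /andP[t0 t1] qE].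
  by have [_] := qK 1%N; exact.
suff H n : Ks n q1 /\ Ks n q2.
  move=> n; apply/eqP; rewrite eq_le; apply/andP; split.
    by have [_] := (H n.+1).1; apply; exact: qK.
  by have [_] := qK n.+1; apply; exact: (H n).1.
elim: n => [//|n [IH1 IH2]].
have [_ qmin] := qK n.+1.
have h1 := qmin _ IH1; have h2 := qmin _ IH2; have e := qE n.
(* The weighted gaps [ta] and [tb] are nonnegative with sum 0, so both vanish. *)
have ta : 0 <= t * (g n q1 - g n q) by rewrite mulr_ge0 ?subr_ge0// ltW.
have tb : 0 <= (1 - t) * (g n q2 - g n q) by rewrite mulr_ge0 ?subr_ge0// ltW.
have e1 : g n q1 = g n q.
  apply/eqP; rewrite -subr_eq0 -(mulrI_eq0 _ (lregP (lt0r_neq0 t0))).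
  by apply/eqP; lra.
have e2 : g n q2 = g n q.
  have t1' : 1 - t != 0 by rewrite subr_eq0 gt_eqF.
  apply/eqP; rewrite -subr_eq0 -(mulrI_eq0 _ (lregP t1')).
  by apply/eqP; lra.
by split; split => // q' Kq'; rewrite ?e1 ?e2; exact: qmin.
Qed.

End LexicographicMinimum.

Section PointwiseTopology.
Variables (R : realType) (I : eqType).
Local Notation F := (prod_topology (fun _ : I => R)).

Lemma continuous_eval (i : I) : continuous (fun q : F => q i).
Proof. exact: (@proj_continuous I (fun=> R) i). Qed.

Lemma continuous_sum_eval (J : finType) (P : pred J) (phi : J -> I) :
  continuous (fun q : F => \sum_(j | P j) q (phi j)).
Proof.
apply: (@continuous_big R J +%R 0 P (@add_continuous R) F).
by move=> j _; exact: continuous_eval.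
Qed.

Lemma closed_eq_fun (T : topologicalType) (f g : T -> R) :
  continuous f -> continuous g -> closed [set q | f q = g q].
Proof.
move=> cf cg.
have -> : [set q | f q = g q] = (fun q => f q - g q) @^-1` [set x | x = 0].
  by apply/seteqP; split => q /= => [->|/eqP]; rewrite ?subrr// subr_eq0 => /eqP.
apply: closed_comp; last exact: closed_eq.
by move=> q _; apply: continuousB; [exact: cf|exact: cg].
Qed.

Lemma compact_unit_box : compact [set q : F | forall i, q i \in `[0, 1]%R].
Proof.
exact: (@tychonoff I (fun=> R) (fun=> [set` `[0, 1]%R])
  (fun=> @segment_compact R 0 1)).
Qed.

End PointwiseTopology.

(** * Word weights, and joinings over the alphabet of pairs *)

Section WordWeights.
Variables (R : realType) (A : finType) (a0 : A).
Local Notation Om := (Omega a0).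
Local Notation cylw := (@cylw A a0).
Variable P : probability Om R.

Lemma mlabel_coord i : mlabel (fun x : Om => x i).
Proof. by move=> a; exact: measurable_coord. Qed.

Lemma mlabel_depends n (I : finType) (f : Om -> I) : depends_on n f -> mlabel f.
Proof. by move=> nf i; exact: measurable_depends nf. Qed.

Lemma cylw_rcons w a :
  cylw (rcons w a) = cylw w `&` (fun x : Om => x (size w)) @^-1` [set a].
Proof.
apply/seteqP; split => x.
  rewrite /cylw size_rcons => wx; split.
    by move=> i iw; rewrite wx ?ltnS 1?ltnW// /word nth_rcons iw.
  by rewrite /preimage/= wx// /word nth_rcons ltnn eqxx.
move=> [wx /= xa] i; rewrite size_rcons ltnS leq_eqVlt => /predU1P[->|iw].
  by rewrite xa /word nth_rcons ltnn eqxx.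
by rewrite wx// /word nth_rcons iw.
Qed.

Lemma cylw_cons a w :
  cylw (a :: w) = (@shift A a0 @^-1` cylw w) `&` (fun x : Om => x 0%N) @^-1` [set a].
Proof.
apply/seteqP; split => [x wx|x [wx /= xa] [|i]].
- by split => [i iw|]; [exact: (wx i.+1)|exact: (wx 0%N)].
- by rewrite xa.
- by rewrite /= ltnS; exact: wx.
Qed.

Lemma pr_cylw_rcons w : \sum_a pr P (cylw (rcons w a)) = pr P (cylw w).
Proof.
rewrite [RHS](pr_label P (mlabel_coord (size w)) (@measurable_cylw A a0 w)).
by apply: eq_bigr => a _; rewrite cylw_rcons.
Qed.

Lemma pr_cylw_cons w :
  \sum_a pr P (cylw (a :: w)) = pr P (@shift A a0 @^-1` cylw w).
Proof.
rewrite [RHS](pr_label P (mlabel_coord 0)); last first.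
  exact: measurable_sh_preimage (@measurable_cylw A a0 w).
by apply: eq_bigr => a _; rewrite cylw_cons.
Qed.

Definition prefix_tuple n (x : Om) : n.-tuple A := [tuple x i | i < n].

Lemma prefix_tupleE n (x : Om) : prefix_tuple n x = mkseq x n :> seq A.
Proof.
by rewrite /prefix_tuple/= /mkseq -val_enum_ord -map_comp.
Qed.

Lemma depends_prefix_tuple n : depends_on n (prefix_tuple n).
Proof.
move=> x y /cyl_mkseq xy; apply: val_inj.
by apply: (etrans (prefix_tupleE n x)); rewrite xy -prefix_tupleE.
Qed.

Lemma preimage_prefix_tuple n (t : n.-tuple A) :
  prefix_tuple n @^-1` [set t] = cylw t.
Proof.
apply/seteqP; split => x /=.
  by move=> <-; rewrite prefix_tupleE -cyl_cylw.
move/cylwP; rewrite size_tuple => xt; apply: val_inj.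
exact: (etrans (prefix_tupleE n x)).
Qed.

Lemma pr_depends n (S : set Om) (p : pred (n.-tuple A)) :
  (forall x, S x <-> p (prefix_tuple n x)) ->
  pr P S = \sum_(t : n.-tuple A | p t) pr P (cylw t).
Proof.
move=> Sp; have Sn : depends_on n S.
  move=> x y xy; apply/propext; rewrite !Sp.
  by rewrite (depends_prefix_tuple xy).
have mS : measurable S.
  by rewrite (_ : S = S @^-1` id)//; exact: (measurable_depends id Sn).
rewrite (pr_label P (mlabel_depends (@depends_prefix_tuple n)) mS).
rewrite [RHS]big_mkcond; apply: eq_bigr => t _; case: ifPn => pt.
  congr (pr P _); rewrite preimage_prefix_tuple; apply/setIidPr.
  by rewrite -preimage_prefix_tuple => x /= xt; apply/Sp; rewrite xt.
rewrite (_ : _ `&` _ = set0) ?pr_set0//; apply/seteqP; split => // x [] /Sp + /= xt.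
by rewrite xt (negbTE pt).
Qed.

End WordWeights.

Section Joinings.
Variables (R : realType) (A : finType) (a0 : A).
Local Notation Om := (Omega a0).
Local Notation B := (A * A)%type.
Local Notation Om2 := (@Omega (A * A)%type (a0, a0)).
Local Notation sh := (@shift A a0).
Local Notation sh2 := (@shift (A * A)%type (a0, a0)).
Local Notation cylw2 := (@cylw (A * A)%type (a0, a0)).
Local Notation cylw := (@cylw A a0).

Definition seq_fst (x : Om2) : Om := fun i => (x i).1.
Definition seq_snd (x : Om2) : Om := fun i => (x i).2.

Lemma measurable_coord2 i (S : set B) : measurable [set x : Om2 | S (x i)].
Proof.
apply: (@measurable_depends _ _ i.+1 B (fun x => x i) S) => x y xy.
by rewrite xy.
Qed.

Lemma measurable_seq_fst : measurable_fun setT seq_fst.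
Proof.
by apply: measurable_to_seq => i a; exact: (@measurable_coord2 i [set b | b.1 = a]).
Qed.

Lemma measurable_seq_snd : measurable_fun setT seq_snd.
Proof.
by apply: measurable_to_seq => i a; exact: (@measurable_coord2 i [set b | b.2 = a]).
Qed.

Lemma measurable_preimage_fst (S : set Om) : measurable S ->
  measurable (seq_fst @^-1` S).
Proof. by move=> mS; rewrite -[X in measurable X]setTI; exact: measurable_seq_fst. Qed.

Lemma measurable_preimage_snd (S : set Om) : measurable S ->
  measurable (seq_snd @^-1` S).
Proof. by move=> mS; rewrite -[X in measurable X]setTI; exact: measurable_seq_snd. Qed.

Variables (nu : probability Om R) (X : set Om).
Hypothesis clX : closed_set X.

Let mX : measurable X. Proof. exact: closed_measurable. Qed.

Definition joining (L : probability Om2 R) :=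
  [/\ invariant L,
      forall S, measurable S -> L (seq_fst @^-1` S) = nu S
    & L (seq_snd @^-1` X) = 1%E].

(** Appending a letter expresses consistency, prepending one expresses shift-invariance. As [X] is
    closed, support over [X] amounts to zero weight for each word whose second row spells a cylinder
    missing [X]. *)
Definition joining_weight (q : seq B -> R) :=
  [/\ forall w, q w \in `[0, 1]%R,
      q [::] = 1,
      forall w, \sum_b q (rcons w b) = q w,
      forall w, \sum_b q (b :: w) = q w
    & (forall u, \sum_(t : (size u).-tuple B | map fst t == u) q t = pr nu (cylw u))
      /\ (forall w, cylw (map snd w) `&` X = set0 -> q w = 0)].

Lemma seq_fst_cylw u (x : Om2) :
  (seq_fst @^-1` cylw u) x <-> map fst (prefix_tuple (size u) x) == u.
Proof.
rewrite /preimage/= cylwP prefix_tupleE; split => [h|/eqP h].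
  by apply/eqP; rewrite -[RHS]h /mkseq -map_comp.
by rewrite -[RHS]h /mkseq -map_comp.
Qed.

Lemma cylw2_snd w : cylw2 w `<=` seq_snd @^-1` (cylw (map snd w)).
Proof.
move=> x /cylwP xw; apply/cylwP; rewrite size_map -[in RHS]xw.
by rewrite /mkseq -map_comp.
Qed.

Lemma joining_weight_pr L : joining L -> joining_weight (fun w => pr L (cylw2 w)).
Proof.
move=> [iL fstL sndL]; split => [w|||w|].
- by rewrite in_itv/= pr_ge0 pr_le1//; exact: measurable_cylw.
- by rewrite cylw_nil pr_setT.
- exact: pr_cylw_rcons.
- by rewrite pr_cylw_cons /pr iL//; exact: measurable_cylw.
split => [u|w wX].
  rewrite [RHS]/pr -fstL; last exact: measurable_cylw.
  by symmetry; exact: (pr_depends L (seq_fst_cylw u)).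
have h : pr L (~` (seq_snd @^-1` X)) = 0.
  by rewrite prC; [rewrite /pr sndL subrr|exact: measurable_preimage_snd].
apply/eqP; rewrite eq_le pr_ge0 andbT -h; apply: pr_mono.
- exact: measurable_cylw.
- by apply: measurableC; exact: measurable_preimage_snd.
- move=> x /cylw2_snd wx /= Xx.
  by have : (cylw (map snd w) `&` X) (seq_snd x) by []; rewrite wX.
Qed.

Lemma joining_of_weight q : joining_weight q ->
  exists2 L, joining L & forall w, L (cylw2 w) = (q w)%:E.
Proof.
move=> [q01 q1 qr qc [qfst qsnd]].
have [L LE] : exists L : probability Om2 R, forall w, L (cylw2 w) = (q w)%:E.
  apply: kolmogorov_extension => // w.
  by have := q01 w; rewrite in_itv/= => /andP[].
exists L => //; split.
- have [L' L'E] := probability_of_pushforward L (@measurable_shift _ (a0, a0)).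
  move=> S mS; rewrite -L'E; apply: probability_cylw_unique mS => w.
  rewrite L'E LE prE; last exact: measurable_sh_preimage (@measurable_cylw _ _ _).
  rewrite -pr_cylw_cons -qc; congr EFin; apply: eq_bigr => b _.
  by rewrite /pr LE.
- have [L' L'E] := probability_of_pushforward L measurable_seq_fst.
  move=> S mS; rewrite -L'E; apply: probability_cylw_unique mS => u.
  rewrite L'E prE; last exact: measurable_preimage_fst (@measurable_cylw _ _ _).
  rewrite prE; last exact: measurable_cylw.
  rewrite -qfst; congr EFin; apply: (etrans (pr_depends L (seq_fst_cylw u))).
  by apply: eq_bigr => t _; rewrite /pr LE.
have mC : measurable (seq_snd @^-1` X) by exact: measurable_preimage_snd.
suff: L (~` (seq_snd @^-1` X)) = 0%E.
  rewrite !prE//; last exact: measurableC.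
  by rewrite prC// => -[/eqP]; rewrite subr_eq0 => /eqP <-.
(* Since [X] is closed, these countably many null cylinders cover the complement of its preimage. *)
pose F w := if `[< cylw (map snd w) `&` X = set0 >] then cylw2 w else set0.
have F0 w : L (F w) = 0%E.
  rewrite /F; case: asboolP => [wX|_]; last by rewrite measure0.
  by rewrite LE qsnd.
have mF w : measurable (F w).
  by rewrite /F; case: asboolP => // _; exact: measurable_cylw.
have sub : ~` (seq_snd @^-1` X) `<=`
    \bigcup_n (oapp F set0 (unpickle n)).
  move=> x /clX[n nX]; pose w := mkseq x n.
  exists (pickle w) => //; rewrite pickleK /= /F asboolT; last first.
    apply/seteqP; split => // y [wy /nX Xy]; apply: Xy; move: wy.
    move/cylwP; rewrite size_map size_mkseq => yw; apply/cyl_mkseq.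
    by rewrite yw /w /mkseq -map_comp.
  by rewrite -cyl_cylw.
have mF' o : measurable (oapp F set0 o).
  by case: o => [w|]; [exact: mF|exact: measurable0].
have F'0 o : L (oapp F set0 o) = 0%E by case: o => [w|]; rewrite ?F0 ?measure0.
apply/eqP; rewrite eq_le measure_ge0 andbT.
apply: (le_trans (measure_sigma_subadditive L (fun=> mF' _) (measurableC mC) sub)).
by rewrite eseries0// => n _ _; exact: F'0.
Qed.

End Joinings.

(** * Compactness of the joinings and an ergodic minimiser *)

Section ErgodicJoining.
Variables (R : realType) (A : finType) (a0 : A).
Local Notation Om := (Omega a0).
Local Notation B := (A * A)%type.
Local Notation Om2 := (@Omega (A * A)%type (a0, a0)).
Local Notation sh := (@shift A a0).
Local Notation sh2 := (@shift (A * A)%type (a0, a0)).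
Local Notation cylw2 := (@cylw (A * A)%type (a0, a0)).
Local Notation cylw := (@cylw A a0).
Variables (nu : probability Om R) (X : set Om).
Hypothesis clX : closed_set X.

Local Notation joining := (joining nu X).
Local Notation sfst := (@seq_fst A a0).
Local Notation ssnd := (@seq_snd A a0).
Local Notation weights := (prod_topology (fun _ : seq B => R)).

Let K : set weights := [set q | joining_weight nu X q].

Lemma closed_joining_weight : closed K.
Proof.
have -> : K = [set q : weights | forall w, q w \in `[0, 1]%R] `&`
    [set q : weights | q [::] = 1] `&`
    (\bigcap_w [set q : weights | \sum_b q (rcons w b) = q w]) `&`
    (\bigcap_w [set q : weights | \sum_b q (b :: w) = q w]) `&`
    (\bigcap_u [set q : weights |
      \sum_(t : (size u).-tuple B | map fst t == u) q t = pr nu (cylw u)]) `&`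
    (\bigcap_(w in [set w | cylw (map snd w) `&` X = set0])
      [set q : weights | q w = 0]).
  apply/seteqP; split => q.
    move=> [h1 h2 h3 h4 [h5 h6]].
    split; [split; [split; [split; [by split|]|]|]|] => w ?.
    - exact: h3.
    - exact: h4.
    - exact: h5.
    - exact: h6.
  move=> [[[[[h1 h2] h3] h4] h5] h6]; split => //.
  - by move=> w; exact: h3.
  - by move=> w; exact: h4.
  - by split => w; [exact: h5|exact: h6].
repeat (apply: closedI || (apply: closed_bigI => ? _)).
- have -> : [set q : weights | forall w, q w \in `[0, 1]%R] =
    \bigcap_w ((fun q : weights => q w) @^-1` [set` `[0, 1]%R]).
    by apply/seteqP; split => q /= h w => [_|]; exact: h.
  apply: closed_bigI => w _; apply: closed_comp; last exact: interval_closed.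
  by move=> q _; exact: continuous_eval.
- by apply: closed_eq_fun; [exact: continuous_eval|exact: cst_continuous].
- by apply: closed_eq_fun; [exact: continuous_sum_eval|exact: continuous_eval].
- by apply: closed_eq_fun; [exact: continuous_sum_eval|exact: continuous_eval].
- by apply: closed_eq_fun; [exact: continuous_sum_eval|exact: cst_continuous].
- by apply: closed_eq_fun; [exact: continuous_eval|exact: cst_continuous].
Qed.

Lemma compact_joining_weight : compact K.
Proof.
apply: subclosed_compact (@compact_unit_box R (seq B)) _.
  exact: closed_joining_weight.
by move=> q [].
Qed.

Lemma joining_cond (L : probability Om2 R) (S : set Om2) :
  ergodic nu -> joining L -> measurable S -> sh2 @^-1` S = S -> 0 < pr L S ->
  exists2 Q, joining Q &
    forall S', measurable S' -> pr L S * pr Q S' = pr L (S' `&` S).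
Proof.
move=> enu [iL fstL sndL] mS iS S0.
have [|Q QE] := probability_cond (P := L) mS.
  by rewrite prE// eqe gt_eqF.
have QEr S' : measurable S' -> pr L S * pr Q S' = pr L (S' `&` S).
  move=> mS'; rewrite {2}/pr QE prE; last exact: measurableI.
  by rewrite -EFinM/= -/(pr L S) mulrC divfK// gt_eqF.
have S0' : pr L S != 0 by rewrite gt_eqF.
exists Q => //; split.
- move=> S' mS'; rewrite !QE; congr (_ * _)%E.
  by rewrite -{1}iS -preimage_setI iL//; exact: measurableI.
- have [m mE] := probability_of_pushforward Q (@measurable_seq_fst A a0).
  (* The first marginal [m] of [Q] is invariant, and [pr L S] times it is dominated by [nu]. *)
  move=> S' mS'; rewrite -mE; apply: (ergodic_extremal S0) => //.
  + move=> S1 mS1; rewrite !mE.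
    have mp : measurable (sfst @^-1` S1) by exact: measurable_preimage_fst.
    have -> : sfst @^-1` (sh @^-1` S1) = sh2 @^-1` (sfst @^-1` S1) by [].
    rewrite !QE; congr (_ * _)%E.
    by rewrite -{1}iS -preimage_setI iL//; exact: measurableI.
  + move=> S1 mS1; have mp : measurable (sfst @^-1` S1).
      exact: measurable_preimage_fst.
    rewrite {2}/pr mE -/(pr Q _) QEr// [leRHS]/pr -fstL// -/(pr L _).
    by apply: pr_mono => //; exact: measurableI.
have mp : measurable (ssnd @^-1` X).
  by apply: measurable_preimage_snd; exact: closed_measurable.
rewrite prE//; congr EFin; apply: (mulfI S0'); rewrite QEr// mulr1.
have h : pr L (~` (ssnd @^-1` X)) = 0 by rewrite prC// /pr sndL subrr.
apply/eqP; rewrite eq_le pr_mono//=; last exact: measurableI.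
(* [S] is covered by its part over [X] and an [L]-null set. *)
apply: (@le_trans _ _ (pr L ((ssnd @^-1` X `&` S) `|` ~` (ssnd @^-1` X)))).
  apply: pr_mono => //.
    by apply: measurableU; [exact: measurableI|exact: measurableC].
  by move=> x Sx; have [Xx|nXx] := pselect ((ssnd @^-1` X) x); [left|right].
apply: (le_trans (pr_setU_le _ _ _)); [exact: measurableI|exact: measurableC|].
by rewrite h addr0.
Qed.

Definition mismatch : set Om2 := [set x | (x 0%N).1 != (x 0%N).2].

Lemma pr_mismatch (L : probability Om2 R) :
  pr L mismatch = \sum_(b : B | b.1 != b.2) pr L (cylw2 [:: b]).
Proof.
have mD : measurable mismatch.
  exact: (@measurable_coord2 _ _ 0 [set b | b.1 != b.2]).
rewrite (pr_label L (@mlabel_coord _ (a0, a0) 0) mD) [RHS]big_mkcond/=.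
apply: eq_bigr => b _; case: ifPn => b12.
  congr (pr L _); apply/seteqP; split => x /=.
    by move=> [_ xb] [|//] _; rewrite xb.
  by move=> /(_ 0%N isT) xb; rewrite /mismatch /preimage/= xb.
rewrite (_ : _ `&` _ = set0) ?pr_set0//; apply/seteqP; split => // x [].
by rewrite /mismatch/= => + /= xb; rewrite xb (negbTE b12).
Qed.

(* A joining minimising the mismatch, then lexicographically all word weights, is an
   extreme point of the joinings; by [ergodic_extremal] conditioning on an invariant
   set preserves the first marginal, so extreme joinings are ergodic. *)
Theorem ergodic_joining (L0 : probability Om2 R) : ergodic nu -> joining L0 ->
  exists L, [/\ joining L, ergodic L & pr L mismatch <= pr L0 mismatch].
Proof.
move=> enu jL0.
(* Index 0 is the mismatch, to be minimised first; index k + 1 is the weight of the word coded by k,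
   or the constant 0 if k codes no word. *)
pose g n (q : weights) := if n is k.+1 then oapp q 0 (unpickle k)
  else \sum_(b : B | b.1 != b.2) q [:: b].
have cg n : continuous (g n).
  case: n => [|n]; first exact: continuous_sum_eval.
  rewrite /g; case: (unpickle n) => [w|] /=; first exact: continuous_eval.
  exact: cst_continuous.
have gpr (L : probability Om2 R) :
    g 0%N (fun w => pr L (cylw2 w)) = pr L mismatch by rewrite pr_mismatch.
have K0 : K !=set0 by eexists; exact: joining_weight_pr jL0.
have [q [Kq qmin qext]] :=
  lex_min_extreme cg compact_joining_weight closed_joining_weight K0.
have [L jL LE] := joining_of_weight clX Kq.
have qE : q = (fun w => pr L (cylw2 w)) by apply/funext => w; rewrite /pr LE.
exists L; split => //; last first.
  by rewrite -!gpr -qE; apply: qmin; exact: joining_weight_pr.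
split; first by case: jL.
move=> S mS iS; rewrite prE//.
have [->|S0] := eqVneq (pr L S) 0; first by left.
have [->|S1] := eqVneq (pr L S) 1; first by right.
have {}S0 : 0 < pr L S by rewrite lt_neqAle eq_sym S0 pr_ge0.
have {}S1 : pr L S < 1 by rewrite lt_neqAle S1 pr_le1.
have mCS := measurableC mS.
have CS0 : 0 < pr L (~` S) by rewrite prC// subr_gt0.
have [Q1 jQ1 Q1E] := joining_cond enu jL mS iS S0.
have [Q2 jQ2 Q2E] := joining_cond enu jL mCS (congr1 setC iS) CS0.
(* [L] is a proper convex combination of its conditionals on [S] and on the complement. Extremality
   will give [Q1 = L], although [Q1] has mass 1 on [S] and [L] has less. *)
have comb S' : measurable S' ->
    pr L S' = pr L S * pr Q1 S' + (1 - pr L S) * pr Q2 S'.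
  move=> mS'; rewrite Q1E// -prC// Q2E// -prU; try exact: measurableI.
    by rewrite -setIUr setUv setIT.
  by rewrite setIACA setICr setI0.
have S01 : 0 < pr L S < 1 by rewrite S0 S1.
have Q1L n := qext _ _ _ (joining_weight_pr clX jQ1) (joining_weight_pr clX jQ2)
  S01 _ n.
have {}Q1L n : g n (fun w => pr Q1 (cylw2 w)) = g n q.
  apply: Q1L => -[|k]; rewrite /g qE.
    rewrite !mulr_sumr -big_split/=; apply: eq_bigr => b _.
    by apply: comb; exact: measurable_cylw.
  case: (unpickle k) => [w|] /=; last by rewrite !mulr0 addr0.
  by apply: comb; exact: measurable_cylw.
have QL : forall S', measurable S' -> Q1 S' = L S'.
  apply: probability_cylw_unique => w; have := Q1L (pickle w).+1.
  rewrite /g pickleK/= qE => h.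
  by rewrite !prE ?h//; exact: measurable_cylw.
have := Q1E _ mS; rewrite setIid {2}/pr QL// -/(pr L S) => h.
exfalso; move: S1; rewrite lt_neqAle => /andP[/eqP + _]; apply.
by apply: (mulfI (lt0r_neq0 S0)); rewrite h mulr1.
Qed.

End ErgodicJoining.

(** * Couplings as joinings, and back *)

Section Couplings.
Variables (R : realType) (A : finType) (a0 : A).
Local Notation Om := (Omega a0).
Local Notation Prob := (probability Om R).
Local Notation Om2 := (@Omega (A * A)%type (a0, a0)).
Local Notation sh := (@shift A a0).
Local Notation sh2 := (@shift (A * A)%type (a0, a0)).

Definition differ : set (Om * Om)%type := [set xy | xy.1 0%N != xy.2 0%N].

Definition zip_seq (xy : (Om * Om)%type) : Om2 := fun i => (xy.1 i, xy.2 i).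

Lemma measurable_zip_seq : measurable_fun setT zip_seq.
Proof.
apply: measurable_to_seq => i [a b].
rewrite (_ : [set _ | _] = [set x : Om | x i = a] `*` [set x : Om | x i = b]).
  by apply: measurableX; exact: measurable_coord.
by apply/seteqP; split => -[x y] /=; rewrite /zip_seq/= => -[-> ->].
Qed.

Lemma measurable_differ_at i :
  measurable [set xy : (Om * Om)%type | xy.1 i != xy.2 i].
Proof.
rewrite (_ : [set _ | _] = zip_seq @^-1` [set x | (x i).1 != (x i).2])//.
rewrite -[X in measurable X]setTI; apply: measurable_zip_seq => //.
exact: (@measurable_coord2 _ _ i [set b | b.1 != b.2]).
Qed.

Lemma measurable_differ : measurable differ.
Proof. exact: measurable_differ_at. Qed.

Definition unzip_seq (x : Om2) : (Om * Om)%type := (seq_fst x, seq_snd x).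

Lemma measurable_unzip_seq : measurable_fun setT unzip_seq.
Proof.
by apply: measurable_fun_pair; [exact: measurable_seq_fst|exact: measurable_seq_snd].
Qed.

Lemma integral_d0 (lam : probability (Om * Om)%type R) :
  (\int[lam]_xy (d0 R xy)%:E)%E = (pr lam differ)%:E.
Proof.
rewrite (_ : (fun xy => _) = (fun xy => (\1_differ xy)%:E)).
  rewrite integral_indic//; last exact: measurable_differ.
  by rewrite setIT -prE//; exact: measurable_differ.
apply/funext => xy; rewrite /d0 indicE; congr EFin.
case: eqP => h; first by rewrite memNset//= /differ/= h eqxx.
by rewrite mem_set//= /differ/=; apply/eqP.
Qed.

(** A pair of sequences is read as a sequence of pairs, which turns the coupling into a joining. The
    new [b'] is ergodic as a factor of an ergodic joining. *)
Lemma ergodic_coupling (X : set Om) (nu b : Prob)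
    (lam : probability (Om * Om)%type R) :
  closed_set X -> ergodic nu -> MS X b -> coupling nu b lam ->
  exists b' lam', [/\ ergodic b', MS X b', coupling nu b' lam'
    & pr lam' differ <= pr lam differ].
Proof.
move=> clX enu [ib bX] [lam1 [lam2 ilam]].
have mX := closed_measurable clX.
have [L0 L0E] := probability_of_pushforward lam measurable_zip_seq.
have mz (S : set Om2) : measurable S -> measurable (zip_seq @^-1` S).
  by move=> mS; rewrite -[X in measurable X]setTI; exact: measurable_zip_seq.
have jL0 : joining nu X L0.
  split => [S mS|S mS|]; rewrite !L0E.
  - by rewrite -(ilam _ (mz _ mS)).
  - rewrite -lam1//; congr (lam _).
    by apply/seteqP; split => -[x y] //= -[].
  - rewrite -bX -lam2//; congr (lam _).
    by apply/seteqP; split => -[x y] //= -[].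
have [L [[iL L1 L2] [_ eL] Lmis]] := ergodic_joining clX enu jL0.
have [b' b'E] := probability_of_pushforward L (@measurable_seq_snd A a0).
have [lam' lam'E] := probability_of_pushforward L measurable_unzip_seq.
have msnd (S : set Om) : measurable S -> measurable (@seq_snd A a0 @^-1` S).
  exact: measurable_preimage_snd.
have ib' : invariant b'.
  by move=> S mS; rewrite !b'E -(iL _ (msnd _ mS)).
exists b', lam'; split.
- split => // S mS iS; rewrite b'E; apply: eL; first exact: msnd.
  by rewrite -{2}iS.
- by split => //; rewrite b'E.
- split => [S mS|]; first by rewrite lam'E -L1//; congr (L _);
    apply/seteqP; split => x //= -[].
  split => [S mS|S mS].
    by rewrite lam'E b'E; congr (L _); apply/seteqP; split => x //= -[].
  rewrite !lam'E -(iL (unzip_seq @^-1` S))//.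
  by rewrite -[X in measurable X]setTI; exact: measurable_unzip_seq.
- have -> : pr lam' differ = pr L (@mismatch A a0) by rewrite /pr lam'E.
  by have -> : pr lam differ = pr L0 (@mismatch A a0) by rewrite /pr L0E.
Qed.

Lemma dbar_lt (mu nu : Prob) (e : R) : (dbar mu nu < e%:E)%E ->
  exists2 lam, coupling mu nu lam & pr lam differ < e.
Proof.
move=> /ereal_inf_lt[_ [lam cl <-]]; rewrite integral_d0 lte_fin => h.
by exists lam.
Qed.

Lemma dbarH_ltl (S T : set Prob) (e : R) (a : Prob) : (dbarH S T < e%:E)%E ->
  S a -> exists b lam, [/\ T b, coupling a b lam & pr lam differ < e].
Proof.
move=> dST Sa.
have : (ereal_inf [set dbar a b | b in T] < e%:E)%E.
  apply: le_lt_trans dST; rewrite /dbarH le_max; apply/orP; left.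
  by apply: ereal_sup_ubound; exists a.
by move=> /ereal_inf_lt[_ [b Tb <-] /dbar_lt[lam ? ?]]; exists b, lam.
Qed.

Lemma dbarH_ltr (S T : set Prob) (e : R) (b : Prob) : (dbarH S T < e%:E)%E ->
  T b -> exists a lam, [/\ S a, coupling a b lam & pr lam differ < e].
Proof.
move=> dST Tb.
have : (ereal_inf [set dbar a b | a in S] < e%:E)%E.
  apply: le_lt_trans dST; rewrite /dbarH le_max; apply/orP; right.
  by apply: ereal_sup_ubound; exists b.
by move=> /ereal_inf_lt[_ [a Sa <-] /dbar_lt[lam ? ?]]; exists a, lam.
Qed.

Lemma coupling_pr_fst (mu nu : Prob) lam (S : set Om) : coupling mu nu lam ->
  measurable S -> pr lam (fst @^-1` S) = pr mu S.
Proof.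
move=> [h _] mS; rewrite /pr -h//; congr (fine (lam _)).
by apply/seteqP; split => -[x y] //= -[].
Qed.

Lemma coupling_pr_snd (mu nu : Prob) lam (S : set Om) : coupling mu nu lam ->
  measurable S -> pr lam (snd @^-1` S) = pr nu S.
Proof.
move=> [_ [h _]] mS; rewrite /pr -h//; congr (fine (lam _)).
by apply/seteqP; split => -[x y] //= -[].
Qed.

Lemma coupling_pr_differ (mu nu : Prob) lam i : coupling mu nu lam ->
  pr lam [set xy | xy.1 i != xy.2 i] = pr lam differ.
Proof.
move=> [_ [_ il]].
by elim: i => // i IH; rewrite -IH /pr -[in RHS]il//; exact: measurable_differ_at.
Qed.

End Couplings.

(** * Entropy *)

Section EntropyFunction.
Variable R : realType.
Implicit Types p q : R.

Lemma etaE p : eta p = - (p * ln p).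
Proof. by rewrite /eta; case: eqP => // ->; rewrite mul0r oppr0. Qed.

Lemma eta0 : eta (0 : R) = 0.
Proof. by rewrite etaE mul0r oppr0. Qed.

Lemma eta1 : eta (1 : R) = 0.
Proof. by rewrite etaE ln1 mulr0 oppr0. Qed.

Lemma eta_ge0 p : 0 <= p <= 1 -> 0 <= eta p.
Proof.
move=> /andP[p0 p1]; rewrite etaE -mulrN mulr_ge0// oppr_ge0.
exact: ln_le0.
Qed.

Lemma ln_le_sub1 p : 0 < p -> ln p <= p - 1.
Proof.
by move=> p0; rewrite -{1}(subrKC 1 p); apply: le_ln1Dx; lra.
Qed.

Lemma eta_le_1B p : 0 <= p -> eta p <= 1 - p.
Proof.
rewrite le_eqVlt => /predU1P[<-|p0]; first by rewrite eta0 subr0.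
have := @ln_le_sub1 p^-1; rewrite invr_gt0 => /(_ p0); rewrite lnV// => h.
rewrite etaE -mulrN.
apply: le_trans (ler_wpM2l (ltW p0) h) _.
by rewrite mulrBr mulr1 divff ?gt_eqF.
Qed.

(** For p = s^2 one has [eta p] = 2 s [eta s], and [eta s] <= 1. This serves as an explicit modulus
    of continuity at 0. *)
Lemma eta_le_sqrt p : 0 <= p -> eta p <= 2 * Num.sqrt p.
Proof.
move=> p0; have := p0; rewrite le_eqVlt => /predU1P[<-|pp].
  by rewrite eta0 sqrtr0 mulr0.
have pE : p = Num.sqrt p * Num.sqrt p by rewrite -expr2 sqr_sqrtr.
have : 0 < Num.sqrt p by rewrite sqrtr_gt0.
move: (Num.sqrt p) pE => s -> s0.
have := eta_le_1B (ltW s0); rewrite !etaE lnM ?posrE// => h.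
have {}h : - (s * ln s) <= 1 by lra.
have := ler_wpM2l (ltW s0) h; lra.
Qed.

Lemma eta_sum (J : finType) (Q : pred J) (p : J -> R) : (forall j, 0 <= p j) ->
  eta (\sum_(j | Q j) p j) <= \sum_(j | Q j) eta (p j).
Proof.
move=> p0; rewrite etaE mulr_suml -sumrN; apply: ler_sum => j Qj.
rewrite etaE lerN2; have := p0 j; rewrite le_eqVlt => /predU1P[<-|pj].
  by rewrite !mul0r.
have le_sum : p j <= \sum_(k | Q k) p k.
  by rewrite (bigD1 j)//= lerDl; apply: sumr_ge0.
rewrite ler_pM2l// ler_ln ?posrE//.
exact: lt_le_trans le_sum.
Qed.

(* Gibbs: [ln (q r / p) <= q r / p - 1]. *)
Lemma eta_gibbs p q r : 0 <= p -> p <= q -> p <= r ->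
  eta p <= - (p * ln q) - p * ln r + (q * r - p).
Proof.
move=> + pq pr; rewrite le_eqVlt => /predU1P[p0|p0].
  have qr : 0 <= q * r by rewrite mulr_ge0// p0.
  by rewrite -p0 eta0 !mul0r; lra.
have q0 := lt_le_trans p0 pq; have r0 := lt_le_trans p0 pr.
have := @ln_le_sub1 (q * r / p); rewrite !mulr_gt0 ?invr_gt0// => /(_ isT).
rewrite !lnM ?posrE ?mulr_gt0 ?invr_gt0// lnV ?posrE// => h.
have := ler_wpM2l (ltW p0) h.
have -> : p * (q * r / p - 1) = q * r - p by field; rewrite gt_eqF.
by rewrite etaE; lra.
Qed.

End EntropyFunction.

(** * Shannon entropy of labels and blocks *)

Section LabelEntropy.
Context d (T : measurableType d) (R : realType) (P : probability T R).

Definition Hl (I : finType) (f : T -> I) : R :=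
  \sum_i eta (pr P (f @^-1` [set i])).

Lemma Hl_ge0 (I : finType) (f : T -> I) : mlabel f -> 0 <= Hl f.
Proof.
move=> mf; apply: sumr_ge0 => i _; apply: eta_ge0.
by rewrite pr_ge0 pr_le1.
Qed.

Lemma Hl_cst (I : finType) (c : I) : Hl (fun=> c) = 0.
Proof.
apply: big1 => i _; have [->|ic] := eqVneq i c.
  by rewrite (_ : _ @^-1` _ = setT) ?pr_setT ?eta1//; apply/seteqP; split.
rewrite (_ : _ @^-1` _ = set0) ?pr_set0 ?eta0//; apply/seteqP; split => // x /=.
by move/eqP; rewrite eq_sym (negbTE ic).
Qed.

Lemma Hl_comp (I J : finType) (f : T -> I) (phi : I -> J) : mlabel f ->
  Hl (phi \o f) <= Hl f.
Proof.
move=> mf; rewrite /Hl.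
rewrite [leRHS](partition_big phi xpredT)//=; apply: ler_sum => j _.
suff -> : pr P ((phi \o f) @^-1` [set j]) =
    \sum_(i | phi i == j) pr P (f @^-1` [set i]).
  by apply: eta_sum => i; exact: pr_ge0.
rewrite (pr_label P mf (mlabel_comp phi mf j)) [RHS]big_mkcond.
apply: eq_bigr => i _; case: eqP => phij.
  by congr (pr P _); apply/setIidPr => x /= ->.
rewrite (_ : _ `&` _ = set0) ?pr_set0//; apply/seteqP; split => // x /= [fj fi].
by apply: phij; rewrite -fi.
Qed.

Lemma Hl_pair (I J : finType) (f : T -> I) (g : T -> J) : mlabel f -> mlabel g ->
  Hl (fun x => (f x, g x)) <= Hl f + Hl g.
Proof.
move=> mf mg; pose p i j := pr P (f @^-1` [set i] `&` g @^-1` [set j]).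
have pE i j : pr P ((fun x => (f x, g x)) @^-1` [set (i, j)]) = p i j.
  by congr (pr P _); apply/seteqP; split => x /= [-> ->].
have fE i : pr P (f @^-1` [set i]) = \sum_j p i j by exact: pr_label.
have gE j : pr P (g @^-1` [set j]) = \sum_i p i j.
  by rewrite (pr_label P mf (mg j)); apply: eq_bigr => i _; rewrite setIC.
have mp i j : measurable (f @^-1` [set i] `&` g @^-1` [set j]).
  exact: measurableI.
have -> : Hl (fun x => (f x, g x)) = \sum_i \sum_j eta (p i j).
  by rewrite pair_big/=; apply: eq_bigr => -[i j] _; rewrite pE.
rewrite /Hl.
set a := fun i => pr P (f @^-1` [set i]).
set b := fun j => pr P (g @^-1` [set j]).
(* Gibbs' inequality against the product of the marginals; the correction terms cancel because in
   each row both parts sum to [a i]. *)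
apply: (@le_trans _ _ (\sum_i \sum_j
    (- (p i j * ln (a i)) - p i j * ln (b j) + (a i * b j - p i j)))).
  apply: ler_sum => i _; apply: ler_sum => j _.
  by apply: eta_gibbs; rewrite ?pr_ge0//; apply: pr_mono => //; exact: mp.
rewrite le_eqVlt; apply/orP; left; apply/eqP.
transitivity (\sum_i (eta (a i) - \sum_j p i j * ln (b j))).
  apply: eq_bigr => i _; rewrite big_split/= !sumrB/= sumrN -mulr_sumr.
  rewrite (pr_labelT P mg) -mulr_suml -fE etaE mulr1 subrr addr0.
  by rewrite -/(a i).
rewrite sumrB; congr (_ + _); rewrite exchange_big/= -sumrN.
by apply: eq_bigr => j _; rewrite etaE -mulr_suml -gE.
Qed.

Definition block (I : finType) (X : nat -> T -> I) n (x : T) : n.-tuple I :=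
  [tuple X i x | i < n].

Section Block.
Variable I : finType.
Implicit Types X Y : nat -> T -> I.

Lemma tnth_block X n x i : tnth (block X n x) i = X i x.
Proof. exact: tnth_mktuple. Qed.

Lemma preimage_block X n (t : n.-tuple I) :
  block X n @^-1` [set t] = [set x | forall i : 'I_n, X i x = tnth t i].
Proof.
apply/seteqP; split => x /=; first by move=> <- i; rewrite tnth_block.
by move=> h; apply: eq_from_tnth => i; rewrite tnth_block.
Qed.

Lemma mlabel_block X n : (forall i, mlabel (X i)) -> mlabel (block X n).
Proof.
move=> mX t; rewrite preimage_block.
rewrite (_ : [set _ | _] = \bigcap_(i in [set: 'I_n]) (X i @^-1` [set tnth t i])).
  by apply: fin_bigcap_measurable => [|i _]; [exact: finite_finset|exact: mX].
by apply/seteqP; split => x /= h i; [move=> _|]; exact: h.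
Qed.

Lemma block_val X n x : tval (block X n x) = mkseq (X^~ x) n.
Proof. by rewrite /block/= /mkseq -val_enum_ord -map_comp. Qed.

Lemma Hl_block_add X m n : (forall i, mlabel (X i)) ->
  Hl (block X (m + n)) <= Hl (block X m) + Hl (block (fun i => X (m + i)%N) n).
Proof.
move=> mX; have mX' i : mlabel (X (m + i)%N) by exact: mX.
apply: (le_trans _ (Hl_pair (mlabel_block mX) (mlabel_block mX'))).
pose phi (uv : m.-tuple I * n.-tuple I) : (m + n).-tuple I := [tuple of uv.1 ++ uv.2].
have -> : block X (m + n) =
    phi \o (fun x => (block X m x, block (fun i => X (m + i)%N) n x)).
  apply/funext => x; apply: val_inj; apply: (etrans (block_val _ _ _)).
  rewrite /= !block_val /mkseq iotaD map_cat add0n; congr (_ ++ _).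
  have -> : iota m n = map (addn m) (iota 0 n) by rewrite -iotaDl addn0.
  by rewrite -val_enum_ord -!map_comp.
by apply: Hl_comp; apply: mlabel_pair; exact: mlabel_block.
Qed.

Lemma Hl_block_sum X n : (forall i, mlabel (X i)) ->
  Hl (block X n) <= \sum_(i < n) Hl (X i).
Proof.
move=> mX; elim: n => [|n IH].
  rewrite big_ord0 (_ : block X 0 = fun=> [tuple]) ?Hl_cst//.
  by apply/funext => x; rewrite tuple0; apply: val_inj.
rewrite big_ord_recr/=; apply: (le_trans _ (lerD IH (lexx _))).
apply: (le_trans _ (Hl_pair (mlabel_block mX) (mX n))).
pose phi (ui : n.-tuple I * I) : n.+1.-tuple I := [tuple of rcons ui.1 ui.2].
have -> : block X n.+1 = phi \o (fun x => (block X n x, X n x)).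
  apply/funext => x; apply: val_inj; apply: (etrans (block_val _ _ _)).
  by rewrite /= block_val /mkseq -addn1 iotaD map_cat add0n/= cats1.
by apply: Hl_comp; apply: mlabel_pair => //; exact: mlabel_block.
Qed.

End Block.

Section Discrepancy.
Variable I : finType.
Implicit Types X Y : nat -> T -> I.

Definition discrepancy (f g : T -> I) (x : T) : option I :=
  if f x == g x then None else Some (f x).

Lemma mlabel_discrepancy f g : mlabel f -> mlabel g -> mlabel (discrepancy f g).
Proof.
move=> mf mg.
exact: (mlabel_comp (fun p : I * I => if p.1 == p.2 then None else Some p.1)
  (mlabel_pair mf mg)).
Qed.

Lemma measurable_neq (f g : T -> I) : mlabel f -> mlabel g ->
  measurable [set x | f x != g x].
Proof.
move=> mf mg.
exact: (mlabel_preimage [set p : I * I | p.1 != p.2] (mlabel_pair mf mg)).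
Qed.

(** The cell [None] has mass at least 1 - e and costs at most e by [eta_le_1B]; each cell [Some i]
    has mass at most e and costs at most 2 sqrt e. *)
Definition discrepancy_bound (e : R) : R := e + #|I|%:R * (2 * Num.sqrt e).

Lemma Hl_discrepancy (f g : T -> I) (e : R) : mlabel f -> mlabel g ->
  pr P [set x | f x != g x] <= e ->
  Hl (discrepancy f g) <= discrepancy_bound e.
Proof.
move=> mf mg fge; have me := mlabel_discrepancy mf mg.
rewrite /Hl (bigD1 None)//=; apply: lerD.
  rewrite (_ : _ @^-1` _ = ~` [set x | f x != g x]); last first.
    by apply/seteqP; split => x; rewrite /discrepancy/=; case: eqP.
  have mC := measurableC (measurable_neq mf mg).
  apply: le_trans (eta_le_1B (pr_ge0 _ _)) _.
  by rewrite prC; [lra|exact: measurable_neq].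
rewrite mulr_natl -sumr_const (reindex_onto Some (odflt (f point)))/=; last by case.
rewrite [leLHS](eq_bigl xpredT); last by move=> i; rewrite eqxx.
rewrite [leRHS](eq_bigl xpredT)//.
apply: ler_sum => i _; apply: le_trans (eta_le_sqrt (pr_ge0 _ _)) _.
rewrite ler_pM2l// ler_wsqrtr//; apply: le_trans fge; apply: pr_mono => //.
  exact: measurable_neq.
by move=> x; rewrite /discrepancy/=; case: eqP.
Qed.

Lemma Hl_block_le X Y n (e : R) :
  (forall i, mlabel (X i)) -> (forall i, mlabel (Y i)) ->
  (forall i, pr P [set x | X i x != Y i x] <= e) ->
  Hl (block X n) <= Hl (block Y n) + n%:R * discrepancy_bound e.
Proof.
move=> mX mY XYe.
pose E i := discrepancy (X i) (Y i).
have mE i : mlabel (E i) by exact: mlabel_discrepancy.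
apply: (@le_trans _ _ (Hl (block Y n) + \sum_(i < n) Hl (E i))); last first.
  rewrite lerD2l mulr_natl -[n in _ *+ n]card_ord -sumr_const.
  by apply: ler_sum => i _; exact: Hl_discrepancy.
apply: (le_trans _ (lerD (lexx _) (Hl_block_sum n mE))).
apply: (le_trans _ (Hl_pair (mlabel_block mY) (mlabel_block mE))).
(* Decoding: keep the letter of [Y] unless a correction overrides it. *)
pose phi (ye : n.-tuple I * n.-tuple (option I)) : n.-tuple I :=
  [tuple odflt (tnth ye.1 i) (tnth ye.2 i) | i < n].
have -> : block X n = phi \o (fun x => (block Y n x, block E n x)).
  apply/funext => x; apply: eq_from_tnth => i; rewrite /= !tnth_mktuple/=.
  by rewrite /E /discrepancy; case: eqP.
by apply: Hl_comp; apply: mlabel_pair; exact: mlabel_block.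
Qed.

End Discrepancy.
End LabelEntropy.

(** Fekete's subadditive lemma: the limit is the infimum of the quotients, finite because [u] is
    nonnegative. *)
Lemma fekete (R : realType) (u : nat -> R) : (forall n, 0 <= u n) ->
  (forall m n, u (m + n)%N <= u m + u n) ->
  cvgn (fun n => u n.+1 / n.+1%:R).
Proof.
move=> u0 uD; pose v n := u n.+1 / n.+1%:R.
have v0 n : 0 <= v n by rewrite divr_ge0.
pose V := [set v n | n in setT].
have hV : has_inf V by split; [exists (v 0%N); exists 0%N|exists 0 => _ [n _ <-]].
suff : v @ \oo --> inf V by move=> ?; apply/cvg_ex; exists (inf V).
apply/cvgrPdist_le => e e0.
have e20 : 0 < e / 2 by rewrite divr_gt0.
have [_ [k _ <-] vk] := inf_adherent e20 hV.
(* One constant that dominates [u r] for every remainder r modulo k + 1. *)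
pose M := \sum_(r < k.+1) u r.
have uM q r : (r < k.+1)%N -> u (q * k.+1 + r)%N <= q%:R * u k.+1 + M.
  move=> rk; elim: q => [|q IH].
    by rewrite mul0n add0n mul0r add0r /M (bigD1 (Ordinal rk))//= lerDl sumr_ge0.
  rewrite mulSn -addnA; apply: le_trans (uD _ _) _.
  by rewrite -natr1 mulrDl mul1r; lra.
have [N NM] : exists N : nat, M / (e / 2) <= N%:R.
  by exists (Num.truncn (M / (e / 2))).+1; apply/ltW; exact: truncnS_gt.
exists N => // n /= Nn.
have infv : inf V <= v n by apply: ge_inf; [case: hV|exists n].
rewrite distrC ger0_norm ?subr_ge0//.
have n0 : 0 < n.+1%:R :> R by [].
have h : u n.+1 <= (n.+1 %/ k.+1)%:R * u k.+1 + M.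
  by rewrite {1}(divn_eq n.+1 k.+1); apply: uM; rewrite ltn_mod.
have uk : u k.+1 = v k * k.+1%:R by rewrite /v divfK.
have h2 : (n.+1 %/ k.+1)%:R * k.+1%:R <= n.+1%:R :> R.
  by rewrite -natrM ler_nat leq_trunc_div.
have h3 : (n.+1 %/ k.+1)%:R * u k.+1 <= n.+1%:R * v k.
  by rewrite uk mulrCA [leRHS]mulrC ler_wpM2l.
have h4 : M <= n.+1%:R * (e / 2).
  rewrite -ler_pdivrMr//; apply: le_trans NM _.
  by rewrite ler_nat; exact: leqW.
have : v n <= v k + e / 2.
  by rewrite {1}/v ler_pdivrMr//; lra.
by lra.
Qed.

(** * Approximation of measurable partitions by finite-range ones *)

Section ClopenApproximation.
Variables (R : realType) (A : finType) (a0 : A).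
Local Notation Om := (Omega a0).
Variable mu : probability Om R.

Lemma measurable_setY (S C : set Om) : measurable S -> measurable C ->
  measurable (S `+` C).
Proof. by move=> mS mC; apply: measurableU; exact: measurableD. Qed.

Definition clopen_approx (S : set Om) := measurable S /\
  forall e, 0 < e -> exists2 C, clopen C & pr mu (S `+` C) < e.

Lemma pr_setY_trans (S1 S2 S3 : set Om) : measurable S1 -> measurable S2 ->
  measurable S3 -> pr mu (S1 `+` S3) <= pr mu (S1 `+` S2) + pr mu (S2 `+` S3).
Proof.
move=> m1 m2 m3; apply: le_trans (pr_setU_le _ _ _); try exact: measurable_setY.
apply: pr_mono; first exact: measurable_setY.
  by apply: measurableU; exact: measurable_setY.
move=> x [[x1 x3]|[x3 x1]]; have [x2|x2] := pselect (S2 x).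
- by right; left.
- by left; left.
- by left; right.
- by right; right.
Qed.

Lemma clopen_approxU S1 S2 : clopen_approx S1 -> clopen_approx S2 ->
  clopen_approx (S1 `|` S2).
Proof.
move=> [m1 a1] [m2 a2]; split => [|e e0]; first exact: measurableU.
have e20 : 0 < e / 2 by rewrite divr_gt0.
have [C1 c1 h1] := a1 _ e20; have [C2 c2 h2] := a2 _ e20.
have mC1 := measurable_clopen c1; have mC2 := measurable_clopen c2.
exists (C1 `|` C2); first exact: clopenU.
rewrite (splitr e); apply: le_lt_trans (ltrD h1 h2).
apply: le_trans (pr_setU_le _ _ _); try exact: measurable_setY.
apply: pr_mono.
- by apply: measurable_setY; exact: measurableU.
- by apply: measurableU; exact: measurable_setY.
move=> x [[[x1|x2] /not_orP[n1 n2]]|[[x1|x2] /not_orP[n1 n2]]].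
- by left; left.
- by right; left.
- by left; right.
- by right; right.
Qed.

(** The approximable sets form a sigma-algebra containing the cylinders. A countable union is first
    replaced, through continuity from below, by a finite one. *)
Lemma measurable_clopen_approx S : measurable S -> clopen_approx S.
Proof.
move: S; suff : @measurable _ Om `<=` clopen_approx by [].
have cA C : clopen C -> clopen_approx C.
  move=> cC; split => [|e e0]; first exact: measurable_clopen.
  by exists C => //; rewrite /setY setDv setU0 pr_set0.
apply: smallest_sub; last first.
  by move=> _ [n [y ->]]; apply: cA; exact: clopen_cyl.
split.
- by apply: cA; exact: clopen0.
- move=> S [mS aS]; rewrite setTD; split => [|e e0]; first exact: measurableC.
  have [C cC h] := aS _ e0; exists (~` C); first exact: clopenC.
  rewrite (_ : _ `+` _ = S `+` C)//; apply/seteqP; split => x.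
    by move=> [[nS /contrapT Cx]|[nC /contrapT Sx]]; [right|left].
  by move=> [[Sx nC]|[Cx nS]]; [right|left]; split => // /(_ _)/=; tauto.
move=> F0 aF; pose F : nat -> set Om := F0; have mF i : measurable (F i) by case: (aF i).
have mU : measurable (\bigcup_i F i) by exact: bigcupT_measurable.
split => // e e0; have e20 : 0 < e / 2 by rewrite divr_gt0.
pose G n := \bigcup_(i < n) F i.
have aG n : clopen_approx (G n).
  rewrite /G bigcup_mkord; apply: (big_ind clopen_approx) => //.
    by apply: cA; exact: clopen0.
  exact: clopen_approxU.
have mG n : measurable (G n) by case: (aG n).
have UG : \bigcup_n G n = \bigcup_i F i.
  apply/seteqP; split => x [n _]; first by case=> i _; exists i.
  by exists n.+1 => //; exists n => /=.
have ndG : nondecreasing_seq G.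
  apply/nondecreasing_seqP => n; rewrite subsetEset => x [i /= ni]; exists i => //=.
  exact: leqW.
have := @nondecreasing_cvg_mu _ _ _ mu G mG; rewrite UG => /(_ mU ndG) cG.
have : pr mu (G n) @[n --> \oo] --> pr mu (\bigcup_i F i).
  by apply: fine_cvg; rewrite -prE.
move=> /cvgrPdist_lt/(_ _ e20)[n _ /(_ n (leqnn n))/= hn].
have [C cC hC] := (aG n).2 _ e20; exists C => //.
have mC := measurable_clopen cC.
apply: le_lt_trans (pr_setY_trans mU (mG n) mC) _.
rewrite (splitr e); apply: ltrD => //.
have GU : G n `<=` \bigcup_i F i by rewrite -UG => x; exists n.
have dU := measurableD mU (mG n).
rewrite /setY (_ : G n `\` _ = set0) ?setU0; last first.
  by apply/seteqP; split => x // [/GU].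
have := prU mu (mG n) dU; rewrite setDUK// setDIK => /(_ erefl) h.
by move: hn; rewrite h; apply: le_lt_trans; rewrite addrAC subrr add0r ler_norm.
Qed.

Lemma label_approx (I : finType) (f : Om -> I) (e : R) : mlabel f -> 0 < e ->
  exists n (g : Om -> I), depends_on n g /\ pr mu [set x | f x != g x] <= e.
Proof.
move=> mf e0.
have I0 : (0 < #|I|)%N by apply/card_gt0P; exists (f point).
have e'0 : 0 < e / #|I|%:R by rewrite divr_gt0// ltr0n.
have /choice[C HC] : forall i, exists C : set Om, clopen C /\
    pr mu (f @^-1` [set i] `+` C) < e / #|I|%:R.
  by move=> i; have [C cC h] := (measurable_clopen_approx (mf i)).2 _ e'0; exists C.
have /choice[N HN] : forall i, exists n, depends_on n (C i).
  by move=> i; exact: (HC i).1.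
(* The sets [C i] may overlap or fail to cover, so [g] picks some admissible label or a default.
   Wherever [g] is wrong, the point lies in one of the symmetric differences [D i]. *)
pose g x := odflt (f point) [pick i | `[< C i x >]].
have gN : depends_on (\max_i N i)%N g.
  move=> x y xy; rewrite /g; congr odflt; apply: eq_pick => i.
  apply/asbool_equiv_eq; rewrite (HN i x y) //.
  by apply: cyl_le xy; exact: leq_bigmax.
exists (\max_i N i)%N, g; split => //.
pose D i := f @^-1` [set i] `+` C i.
have mD i : measurable (D i).
  by apply: measurable_setY => //; apply: measurable_clopen; exact: (HC i).1.
have sub : [set x | f x != g x] `<=` \big[setU/set0]_i D i.
  move=> x /= /eqP fg; apply: contrapT => nD.
  have nDi i : ~ D i x.
    move=> Di; apply: nD; rewrite -bigcup_seq.
    by exists i => //=; rewrite mem_index_enum.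
  apply: fg; rewrite /g; case: pickP => [i /asboolP Cix|/(_ (f x))/asboolP nC] /=.
    by apply: contrapT => fi; apply: (nDi i); right.
  by exfalso; apply: (nDi (f x)); left.
have mg : mlabel g by exact: mlabel_depends gN.
have mU (s : seq I) : measurable (\big[setU/set0]_(i <- s) D i).
  by elim/big_ind: _ => // *; exact: measurableU.
apply: (le_trans (pr_mono mu (measurable_neq mf mg) (mU _) sub)).
have sD (s : seq I) : pr mu (\big[setU/set0]_(i <- s) D i) <= \sum_(i <- s) pr mu (D i).
  elim: s => [|i s IH]; first by rewrite !big_nil pr_set0.
  by rewrite !big_cons; apply: (le_trans (pr_setU_le _ (mD _) (mU _))); rewrite lerD2l.
apply: (le_trans (sD _)).
apply: (@le_trans _ _ (\sum_(i : I) (e / #|I|%:R))).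
  by apply: ler_sum => i _; apply: ltW; exact: (HC i).2.
by rewrite sumr_const -[leLHS]mulr_natr divfK// pnatr_eq0 -lt0n.
Qed.

End ClopenApproximation.

Lemma lim_le_add (R : realType) (u v : nat -> R) (e : R) : cvgn u -> cvgn v ->
  (\forall n \near \oo, u n <= v n + e) -> limn u <= limn v + e.
Proof.
move=> cu cv uv.
have ce : cvgn (fun=> e : R) by exact: is_cvg_cst.
have -> : limn v + e = limn (fun n => v n + e).
  by rewrite (@limD _ _ _ _ _ v (fun=> e))// lim_cst.
by apply: ler_lim => //; exact: is_cvgD.
Qed.

Lemma discrepancy_bound_small (R : realType) (I : finType) (e : R) : 0 < e ->
  exists2 d : R, 0 < d & discrepancy_bound I d <= e.
Proof.
move=> e0; pose c : R := 1 + 2 * #|I|%:R.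
have c0 : 1 <= c by rewrite lerDl mulr_ge0.
(* The witness is s^2, so the root disappears; since s <= 1, the bound is at most s (1 + 2 #|I|) = s
   c. *)
pose s := Num.min 1 (e / c).
have ec0 : 0 < e / c by rewrite divr_gt0//; lra.
have s0 : 0 < s by rewrite lt_min ltr01.
have s1 : s <= 1 by rewrite ge_min lexx.
have se : s <= e / c by rewrite ge_min lexx orbT.
exists (s ^+ 2); first by rewrite exprn_gt0.
rewrite /discrepancy_bound sqrtr_sqr gtr0_norm//.
have : s * c <= e by rewrite -ler_pdivlMr//; lra.
have : s ^+ 2 <= s by rewrite expr2 ler_piMr// ltW.
by rewrite /c; lra.
Qed.

(** * Entropy rate, the generating partition, and couplings *)

Section ShiftEntropy.
Variables (R : realType) (A : finType) (a0 : A).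
Local Notation Om := (Omega a0).
Local Notation Prob := (probability Om R).
Local Notation sh := (@shift A a0).

Definition process (I : finType) (f : Om -> I) i : Om -> I := f \o iter i sh.

Lemma mlabel_process (I : finType) (f : Om -> I) i :
  mlabel f -> mlabel (process f i).
Proof. by move=> mf j; rewrite comp_preimage; exact: measurable_ish_preimage. Qed.

Lemma block_coord n : block (process (fun x : Om => x 0%N)) n = @prefix_tuple A a0 n.
Proof.
apply/funext => x; apply: eq_from_tnth => i.
by rewrite tnth_block tnth_mktuple /process/= iter_shiftE addn0.
Qed.

Section Invariant.
Variable mu : Prob.
Hypothesis imu : invariant mu.

Lemma Hl_process_shift (I : finType) (f : Om -> I) m n : mlabel f ->
  Hl mu (block (fun i => process f (m + i)%N) n) = Hl mu (block (process f) n).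
Proof.
move=> mf; apply: eq_bigr => t _; congr eta.
have mB : measurable (block (process f) n @^-1` [set t]).
  by apply: mlabel_block => i; exact: mlabel_process.
rewrite [RHS]/pr -(invariant_iter m imu mB); congr (fine (mu _)).
apply/seteqP; split => x; rewrite /preimage/= => <-; apply: eq_from_tnth => i;
  by rewrite !tnth_block /process/= addnC iterD.
Qed.

Lemma is_cvg_process (I : finType) (f : Om -> I) : mlabel f ->
  cvgn (fun n => Hl mu (block (process f) n.+1) / n.+1%:R).
Proof.
move=> mf; have mp i : mlabel (process f i) by exact: mlabel_process.
apply: (@fekete R (fun n => Hl mu (block (process f) n))) => [n|m n].
  by apply: Hl_ge0; exact: mlabel_block.
by rewrite -[X in _ <= _ + X](Hl_process_shift m n mf); exact: Hl_block_add.
Qed.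

Definition symbolic_entropy : R :=
  limn (fun n => Hl mu (@prefix_tuple A a0 n.+1) / n.+1%:R).

Lemma is_cvg_symbolic : cvgn (fun n => Hl mu (@prefix_tuple A a0 n.+1) / n.+1%:R).
Proof.
have := is_cvg_process (@mlabel_coord A a0 0).
by under eq_fun do rewrite block_coord.
Qed.

Lemma Hl_prefix_add m n : Hl mu (@prefix_tuple A a0 (m + n)) <=
  Hl mu (@prefix_tuple A a0 m) + Hl mu (@prefix_tuple A a0 n).
Proof.
rewrite -!block_coord -[X in _ <= _ + X](Hl_process_shift m); last exact: mlabel_coord.
by apply: Hl_block_add => i; apply: mlabel_process; exact: mlabel_coord.
Qed.

Lemma depends_Hl_prefix (I : finType) (f : Om -> I) n : depends_on n f ->
  Hl mu f <= Hl mu (@prefix_tuple A a0 n).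
Proof.
move=> nf; have -> : f = (fun t : n.-tuple A => f (@word A a0 t)) \o @prefix_tuple A a0 n.
  apply/funext => x /=; apply: nf => i ni.
  by rewrite prefix_tupleE /word nth_mkseq.
by apply: Hl_comp; exact: mlabel_depends (@depends_prefix_tuple A a0 _).
Qed.

Lemma depends_block_process (I : finType) (f : Om -> I) N n : depends_on N f ->
  depends_on (n + N) (block (process f) n).
Proof.
move=> Nf x y xy; apply: eq_from_tnth => i; rewrite !tnth_block; apply: Nf => j jN.
rewrite !iter_shiftE; apply: xy.
by have := ltn_ord i; lia.
Qed.

(* The coordinate partition generates: any partition is approximated by one that depends
   on finitely many coordinates, at the price of a small discrepancy entropy per symbol. *)
Theorem kolmogorov_sinai (I : finType) (f : Om -> I) : mlabel f ->
  limn (fun n => Hl mu (block (process f) n.+1) / n.+1%:R) <= symbolic_entropy.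
Proof.
move=> mf; apply/ler_addgt0Pr => e e0.
have e20 : 0 < e / 2 by rewrite divr_gt0.
have [d d0 de] := discrepancy_bound_small I e20.
have [N [g [Ng fg]]] := label_approx mu mf d0.
have mg : mlabel g by exact: mlabel_depends Ng.
apply: lim_le_add; [exact: is_cvg_process|exact: is_cvg_symbolic|].
(* A [g]-block of length n reads at most N further letters. Their entropy is at most [c], which
   costs e / 2 per symbol once n is large; the discrepancy takes the other e / 2. *)
pose c := Hl mu (@prefix_tuple A a0 N).
exists (Num.truncn (c / (e / 2))).+1 => // n /= Nn.
have cn : c <= n.+1%:R * (e / 2).
  rewrite -ler_pdivrMr//; apply: le_trans (ltW (truncnS_gt _)) _.
  by rewrite ler_nat; exact: leqW.
rewrite ler_pdivrMr// mulrDl divfK//.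
have mpf i : mlabel (process f i) by exact: mlabel_process.
have mpg i : mlabel (process g i) by exact: mlabel_process.
have pfg i : pr mu [set x | process f i x != process g i x] <= d.
  rewrite /pr (_ : [set _ | _] = iter i sh @^-1` [set x | f x != g x])//.
  by rewrite invariant_iter//; exact: measurable_neq.
apply: (le_trans (Hl_block_le n.+1 mpf mpg pfg)).
apply: (@le_trans _ _ (Hl mu (@prefix_tuple A a0 n.+1) + c + n.+1%:R * (e / 2))).
  apply: lerD; last by rewrite ler_wpM2l.
  apply: le_trans (depends_Hl_prefix (@depends_block_process _ _ N n.+1 Ng)) _.
  exact: Hl_prefix_add.
by rewrite -addrA lerD2l; lra.
Qed.

Lemma hpart_label m (P : 'I_m -> set Om) (f : Om -> 'I_m) :
  (forall i, f @^-1` [set i] = P i) ->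
  hpart mu P = limn (fun n => Hl mu (block (process f) n.+1) / n.+1%:R).
Proof.
move=> fP; have e n : Hjoin mu P n = Hl mu (block (process f) n).
  apply: eq_bigr => t _; congr (eta (fine (mu _))).
  rewrite preimage_block; apply/seteqP; split => x /= h i.
    by have := h i; rewrite -fP.
  by rewrite -fP; exact: h.
by rewrite /hpart; under eq_fun do rewrite e.
Qed.

Lemma partition_label m (P : 'I_m -> set Om) : is_mpartition P ->
  exists2 f : Om -> 'I_m, mlabel f & forall i, f @^-1` [set i] = P i.
Proof.
move=> [mP [dP cP]]; have /choice[f fP] := cP.
have fE i : f @^-1` [set i] = P i.
  apply/seteqP; split => x /=; first by move=> <-.
  move=> Px; apply/eqP; apply: contrapT => /negP fi.
  by have : (P (f x) `&` P i) x by []; rewrite dP.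
by exists f => // i; rewrite fE.
Qed.

(** [kolmogorov_sinai] bounds every partition, and the coordinate partition attains the bound after
    relabelling [A] by ordinals, which is how partitions are indexed. *)
Lemma entropyE : entropy mu = symbolic_entropy%:E.
Proof.
apply/eqP; rewrite eq_le; apply/andP; split.
  apply: ge_ereal_sup => _ [m [P [mP ->]]].
  have [f mf fP] := partition_label mP.
  by rewrite lee_fin (hpart_label fP); exact: kolmogorov_sinai.
pose f (x : Om) := enum_rank (x 0%N).
have mf : mlabel f by apply: mlabel_comp; exact: mlabel_coord.
apply: ereal_sup_ubound; exists #|A|, (fun i => f @^-1` [set i]); split.
  split => //; split => [i j ij|x]; last by exists (f x).
  apply/seteqP; split => x //= [->] /eqP.
  by rewrite (negbTE ij).
suff e n : Hl mu (block (process f) n) = Hl mu (@prefix_tuple A a0 n).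
  by rewrite (@hpart_label _ _ f)//; under [in RHS]eq_fun do rewrite e.
apply/eqP; rewrite eq_le; apply/andP; split.
  pose phi (t : n.-tuple A) := [tuple of map enum_rank t].
  have -> : block (process f) n = phi \o @prefix_tuple A a0 n.
    apply/funext => x; apply: eq_from_tnth => i.
    rewrite tnth_block [RHS]tnth_map tnth_mktuple /process/f/=.
    by rewrite iter_shiftE addn0.
  by apply: Hl_comp; exact: mlabel_depends (@depends_prefix_tuple A a0 _).
pose phi (t : n.-tuple 'I_#|A|) := [tuple of map enum_val t].
have -> : @prefix_tuple A a0 n = phi \o block (process f) n.
  apply/funext => x; apply: eq_from_tnth => i.
  rewrite [RHS]tnth_map tnth_block tnth_mktuple /process/f/= enum_rankK.
  by rewrite iter_shiftE addn0.
by apply: Hl_comp; apply: mlabel_block => i; exact: mlabel_process.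
Qed.

End Invariant.

Section CouplingEntropy.
Variables (mu nu : Prob) (lam : probability (Om * Om)%type R) (e : R).
Hypotheses (imu : invariant mu) (inu : invariant nu) (cl : coupling mu nu lam)
  (le : pr lam (@differ A a0) <= e).

Let X i (xy : (Om * Om)%type) : A := xy.1 i.
Let Y i (xy : (Om * Om)%type) : A := xy.2 i.

Let mX i : mlabel (X i).
Proof.
move=> a; rewrite -[X in measurable X]setTI.
exact: (@measurable_fst _ _ Om Om _ [set x : Om | x i = a]) (measurable_coord _ _).
Qed.

Let mY i : mlabel (Y i).
Proof.
move=> a; rewrite -[X in measurable X]setTI.
exact: (@measurable_snd _ _ Om Om _ [set x : Om | x i = a]) (measurable_coord _ _).
Qed.

Let HX n : Hl lam (block X n) = Hl mu (@prefix_tuple A a0 n).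
Proof.
apply: eq_bigr => t _; congr eta; rewrite -(coupling_pr_fst cl)//.
exact: mlabel_depends (@depends_prefix_tuple A a0 _) t.
Qed.

Let HY n : Hl lam (block Y n) = Hl nu (@prefix_tuple A a0 n).
Proof.
apply: eq_bigr => t _; congr eta; rewrite -(coupling_pr_snd cl)//.
exact: mlabel_depends (@depends_prefix_tuple A a0 _) t.
Qed.

(** Both processes live on the coupled space, and by stationarity they disagree equally often at
    each time. The block estimate is linear in n, so it survives division by n and the limit. *)
Lemma symbolic_entropy_coupling :
  `|symbolic_entropy mu - symbolic_entropy nu| <= discrepancy_bound A e.
Proof.
have XY i : pr lam [set xy | X i xy != Y i xy] <= e.
  by rewrite (coupling_pr_differ i cl).
have YX i : pr lam [set xy | Y i xy != X i xy] <= e.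
  by rewrite (_ : [set _ | _] = [set xy | X i xy != Y i xy])//;
    apply/seteqP; split => xy /=; rewrite eq_sym.
have h1 : symbolic_entropy mu <= symbolic_entropy nu + discrepancy_bound A e.
  apply: lim_le_add; [exact: is_cvg_symbolic|exact: is_cvg_symbolic|].
  apply: nearW => n; rewrite ler_pdivrMr// mulrDl divfK// mulrC -HX -HY mulrC.
  by rewrite [X in _ <= _ + X]mulrC; exact: Hl_block_le.
have h2 : symbolic_entropy nu <= symbolic_entropy mu + discrepancy_bound A e.
  apply: lim_le_add; [exact: is_cvg_symbolic|exact: is_cvg_symbolic|].
  apply: nearW => n; rewrite ler_pdivrMr// mulrDl divfK// -HX -HY.
  by rewrite [X in _ <= _ + X]mulrC; exact: Hl_block_le.
by rewrite ler_norml; apply/andP; split; lra.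
Qed.

End CouplingEntropy.
End ShiftEntropy.

(** * Integrals along couplings *)

Section BoundedIntegrals.
Context d (T : measurableType d) (R : realType) (P : probability T R).

Lemma bounded_integrable (h : T -> R) (M : R) : measurable_fun setT h ->
  (forall x, `|h x| <= M) -> P.-integrable setT (EFin \o h).
Proof.
move=> mh hM; apply: measurable_bounded_integrable => //.
  by rewrite /= probability_setT ltry.
exists M; split; rewrite ?num_real// => y My x _ /=.
exact: le_trans (hM x) (ltW My).
Qed.

Definition expect (h : T -> R) : R := fine (\int[P]_x (h x)%:E)%E.

Lemma expectE (h : T -> R) (M : R) : measurable_fun setT h ->
  (forall x, `|h x| <= M) -> (\int[P]_x (h x)%:E)%E = (expect h)%:E.
Proof.
move=> mh hM; rewrite /expect fineK//; apply: integrable_fin_num => //.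
exact: bounded_integrable mh hM.
Qed.

(** Meant for a bad set [D], where two sequences differ on a long prefix: the error is at most e off
    [D], with excess c on it. *)
Lemma expect_dist (h1 h2 : T -> R) (M e c : R) (D : set T) :
  measurable_fun setT h1 -> measurable_fun setT h2 ->
  (forall x, `|h1 x| <= M) -> (forall x, `|h2 x| <= M) ->
  measurable D -> 0 <= e -> 0 <= c ->
  (forall x, `|h1 x - h2 x| <= e + c * \1_D x) ->
  `|expect h1 - expect h2| <= e + c * pr P D.
Proof.
move=> m1 m2 b1 b2 mD e0 c0 h12.
have i1 := bounded_integrable m1 b1; have i2 := bounded_integrable m2 b2.
rewrite -lee_fin EFinD EFinM -prE//.
have -> : (`|expect h1 - expect h2|%:E = `|\int[P]_x ((h1 x)%:E - (h2 x)%:E)|)%E.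
  rewrite integralB_EFin// (expectE m1 b1) (expectE m2 b2).
  by rewrite -EFinB.
have mB : measurable_fun setT (fun x => h1 x - h2 x) by exact: measurable_funB.
apply: le_trans (le_abse_integral _ _ _) _ => //.
  exact/measurable_EFinP.
apply: (@le_trans _ _ (\int[P]_x (e%:E + (c * \1_D x)%:E))%E).
  apply: ge0_le_integral => //.
  - by apply/measurable_EFinP; exact: measurableT_comp mB.
  - apply/measurable_EFinP; apply: measurable_funD => //.
    by apply: measurable_funM => //; exact: measurable_indic.
  - by move=> x _; rewrite -EFinB -EFinD/= lee_fin.
rewrite ge0_integralD//; last 2 first.
- by move=> x _; rewrite lee_fin mulr_ge0.
- by apply/measurable_EFinP; exact: measurable_funM.
rewrite integral_cst//= probability_setT mule1 leeD2l//.
under eq_integral do rewrite EFinM.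
rewrite ge0_integralZl_EFin//; last first.
  by apply/measurable_EFinP; exact: measurable_indic.
by rewrite integral_indic// setIT.
Qed.

End BoundedIntegrals.

Lemma expect_pushforward d d' (T : measurableType d) (T' : measurableType d')
    (R : realType) (P : probability T R) (Q : probability T' R) (phi : T -> T')
    (h : T' -> R) (M : R) :
  measurable_fun setT phi -> measurable_fun setT h -> (forall x, `|h x| <= M) ->
  (forall S, measurable S -> Q S = P (phi @^-1` S)) ->
  expect Q h = expect P (h \o phi).
Proof.
move=> mphi mh hM QP; rewrite /expect; congr fine.
transitivity (\int[pushforward P phi]_y (h y)%:E)%E.
  by apply: eq_measure_integral => S mS _; exact: QP.
rewrite integral_pushforward//; first exact/measurable_EFinP.
have mhp : measurable_fun setT (h \o phi) by exact: measurableT_comp.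
exact: (@bounded_integrable _ _ _ P (h \o phi) M mhp (fun x => hM _)).
Qed.

Section WeakContinuity.
Variables (R : realType) (A : finType) (a0 : A).
Local Notation Om := (Omega a0).
Local Notation Prob := (probability Om R).

Lemma continuous_fun_bounded (f : Om -> R) : continuous_fun f ->
  exists2 M, 0 <= M & forall x, `|f x| <= M.
Proof.
move=> cf; have [n nf] := continuous_fun_unif ltr01 cf.
(* Up to an error below 1, [f] takes only these finitely many values. *)
pose M := \sum_(t : n.-tuple A) `|f (@word A a0 t)|.
have M0 : 0 <= M by apply: sumr_ge0.
exists (1 + M) => [|x]; first by rewrite addr_ge0.
pose t := @prefix_tuple A a0 n x.
have /nf h : @cyl A a0 n x (@word A a0 t).
  by move=> i ni; rewrite /t prefix_tupleE /word nth_mkseq.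
rewrite -(subrK (f (@word A a0 t)) (f x)); apply: le_trans (ler_normD _ _) _.
apply: lerD; first exact: ltW.
by rewrite /M (bigD1 t)//= lerDl; apply: sumr_ge0.
Qed.

Lemma not_cylE N : [set xy : (Om * Om)%type | ~ @cyl A a0 N xy.1 xy.2] =
  \bigcup_(i < N) [set xy : (Om * Om)%type | xy.1 i != xy.2 i].
Proof.
apply/seteqP; split => xy /=.
  move=> h; apply: contrapT => h'; apply: h => i iN; apply/eqP.
  by rewrite eq_sym; apply: contrapT => /negP ne; apply: h'; exists i.
by move=> [i /= iN /eqP ne] h; apply: ne; rewrite h.
Qed.

Lemma measurable_not_cyl N :
  measurable [set xy : (Om * Om)%type | ~ @cyl A a0 N xy.1 xy.2].
Proof.
by rewrite not_cylE; apply: bigcup_measurable => i _; exact: measurable_differ_at.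
Qed.

(** Union bound over N positions, equally likely to disagree by invariance of the coupling. *)
Lemma coupling_pr_cyl (mu nu : Prob) lam N : coupling mu nu lam ->
  pr lam [set xy | ~ @cyl A a0 N xy.1 xy.2] <= N%:R * pr lam (@differ A a0).
Proof.
move=> cl; elim: N => [|N IH].
  rewrite mul0r (_ : [set _ | _] = set0) ?pr_set0//.
  by apply/seteqP; split => xy //=; apply.
have -> : [set xy : (Om * Om)%type | ~ @cyl A a0 N.+1 xy.1 xy.2] =
    [set xy | ~ @cyl A a0 N xy.1 xy.2] `|` [set xy | xy.1 N != xy.2 N].
  by rewrite !not_cylE !bigcup_mkord big_ord_recr.
apply: (le_trans (pr_setU_le lam (measurable_not_cyl N) (measurable_differ_at N))).
by rewrite (coupling_pr_differ N cl) -natr1 mulrDl mul1r lerD2r.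
Qed.

Lemma expect_coupling (f : Om -> R) (e : R) : continuous_fun f -> 0 < e ->
  exists2 d, 0 < d & forall (mu nu : Prob) lam, coupling mu nu lam ->
    pr lam (@differ A a0) <= d -> `|expect mu f - expect nu f| < e.
Proof.
move=> cf e0; have mf := measurable_continuous_fun cf.
have [M M0 fM] := continuous_fun_bounded cf.
have e20 : 0 < e / 2 by rewrite divr_gt0.
have [N Nf] := continuous_fun_unif e20 cf.
(* The summand 1 keeps [c] positive when [M] or [N] is 0. With mismatch at most e / (4 c), the bad
   prefixes cost at most e / 4, for a total of at most 3 e / 4. *)
pose c := 2 * M * N%:R + 1.
have c0 : 0 < c by rewrite ltr_wpDl// !mulr_ge0.
exists (e / 2 / 2 / c) => [|mu nu lam cl ld]; first by rewrite !divr_gt0.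
have [cl1 [cl2 _]] := cl.
rewrite (@expect_pushforward _ _ _ _ _ lam mu fst f M)//; last first.
  by move=> S mS; rewrite -cl1//; congr (lam _); apply/seteqP; split => -[x y] //= -[].
rewrite (@expect_pushforward _ _ _ _ _ lam nu snd f M)//; last first.
  by move=> S mS; rewrite -cl2//; congr (lam _); apply/seteqP; split => -[x y] //= -[].
pose D := [set xy : (Om * Om)%type | ~ @cyl A a0 N xy.1 xy.2].
have mD : measurable D by exact: measurable_not_cyl.
have h := @expect_dist _ _ _ lam (f \o fst) (f \o snd) M (e / 2) (2 * M) D.
apply: le_lt_trans (h _ _ _ _ _ _ _ _) _ => //.
- exact: measurableT_comp.
- exact: measurableT_comp.
- by move=> x; exact: fM.
- by move=> x; exact: fM.
- exact: ltW.
- by rewrite mulr_ge0.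
- move=> xy /=; rewrite indicE; have [xyN|xyN] := pselect (@cyl A a0 N xy.1 xy.2).
    by rewrite memNset//= mulr0 addr0 ltW//; exact: Nf.
  rewrite mem_set//= mulr1; apply: le_trans (ler_normB _ _) _.
  by have := fM xy.1; have := fM xy.2; lra.
- have := coupling_pr_cyl N cl; rewrite -/D => hD.
  have h1 : 2 * M * pr lam D <= 2 * M * (N%:R * pr lam (@differ A a0)).
    by rewrite ler_wpM2l// mulr_ge0.
  have h2 : c * pr lam (@differ A a0) <= e / 2 / 2.
    by rewrite mulrC -ler_pdivlMr.
  have := pr_ge0 lam (@differ A a0).
  by move: h2; rewrite /c; lra.
Qed.

End WeakContinuity.

(** * Transfer of entropy-density *)

Lemma common_modulus (R : realType) n (P : 'I_n -> R -> Prop) :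
  (forall i, exists2 d, 0 < d & P i d) ->
  (forall i d d', 0 < d' <= d -> P i d -> P i d') ->
  exists2 d, 0 < d & forall i, P i d.
Proof.
move=> exP monoP; have /choice[d dP] i : exists d, 0 < d /\ P i d.
  by have [d d0 Pd] := exP i; exists d.
(* Starting the minimum at 1 covers an empty family of test functions. *)
have m0 : 0 < \big[Num.min/1]_i d i.
  by apply: lt_bigmin => // i _; exact: (dP i).1.
exists (\big[Num.min/1]_i d i) => // i; apply: (monoP i (d i)); last exact: (dP i).2.
by rewrite m0 bigmin_le.
Qed.

Theorem mainTheorem8 (R : realType) (A : finType) (a0 : A)
    (Xk : nat -> set (Omega a0)) (X : set (Omega a0)) :
  (forall k, is_shift_space (Xk k)) ->
  is_shift_space X ->
  (dbarH (@MS R A a0 (Xk k)) (@MS R A a0 X) @[k --> \oo] --> 0%E) ->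
  (forall k, entropy_dense R (Xk k)) ->
  entropy_dense R X.
Proof.
move=> _ [_ [clX _]] dXk edXk mu muX U [n [f [r [r0 [cf fU]]]]] e e0.
(* One third for each link of the chain from [mu] to [a], to [nu], to [b']. *)
have r30 : 0 < r / 3 by rewrite divr_gt0.
have e30 : 0 < e / 3 by rewrite divr_gt0.
have [d1 d10 hd1] : exists2 d, 0 < d & forall i (m m' : probability (Omega a0) R) lam,
    coupling m m' lam -> pr lam (@differ A a0) <= d ->
    `|expect m (f i) - expect m' (f i)| < r / 3.
  apply: (@common_modulus R n) => [i|i d d' /andP[_ d'd] h m m' lam cl ld].
    exact: expect_coupling (cf i) r30.
  exact: h cl (le_trans ld d'd).
have [d2 d20 hd2] := discrepancy_bound_small A e30.
pose d : R := Num.min d1 d2.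
have d0 : 0 < d by rewrite lt_min d10.
have [k dk] : exists k, (dbarH (@MS R A a0 (Xk k)) (@MS R A a0 X) < d%:E)%E.
  have [N _ /(_ N (leqnn N)) h] := dXk _ (@open_ereal_lt' R 0%E d%:E d0).
  by exists N.
have [a [lam1 [aXk cl1 ld1]]] := dbarH_ltr dk muX.
have JE i (m : probability (Omega a0) R) : (\int[m]_x (f i x)%:E)%E = (expect m (f i))%:E.
  have [M _ fM] := continuous_fun_bounded (cf i).
  exact: expectE (measurable_continuous_fun (cf i)) fM.
(* The neighbourhood of [a] uses the same test functions as [U], with radius r / 3. *)
have [|nu [enu [nuXk [[_ nua] hnu]]]] := edXk k a aXk
  [set m : probability (Omega a0) R | MS (Xk k) m /\ forall i : 'I_n,
    (`|\int[m]_x (f i x)%:E - \int[a]_x (f i x)%:E| < (r / 3)%:E)%E] _ (e / 3) e30.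
  by exists n, f, (r / 3); split => //; split => //.
(* The other half of the Hausdorff distance returns to [X]; [ergodic_coupling] then trades [b] for
   an ergodic [b'] without increasing the mismatch. *)
have [b [lam2 [bX cl2 ld2]]] := dbarH_ltl dk nuXk.
have [b' [lam [eb' b'X cl ld]]] := ergodic_coupling clX enu bX cl2.
have {}ld1 : pr lam1 (@differ A a0) <= d by exact: ltW.
have {}ld : pr lam (@differ A a0) <= d by apply: le_trans ld (ltW ld2).
have dd1 : d <= d1 by rewrite ge_min lexx.
have dd2 : d <= d2 by rewrite ge_min lexx orbT.
exists b'; split => //; split => //; split.
  apply: fU; split => // i; have := nua i; rewrite !JE -!EFinB !abse_EFin !lte_fin.
  have := hd1 i _ _ _ cl1 (le_trans ld1 dd1).
  have := hd1 i _ _ _ cl (le_trans ld dd1).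
  by rewrite !ltr_norml => /andP[? ?] /andP[? ?] /andP[? ?]; apply/andP; split; lra.
have [imu _] := muX; have [ia _] := aXk; have [inu _] := nuXk; have [ib' _] := b'X.
move: hnu; rewrite !entropyE// -!EFinB !abse_EFin !lte_fin.
have := le_trans (symbolic_entropy_coupling ia imu cl1 (le_trans ld1 dd2)) hd2.
have := le_trans (symbolic_entropy_coupling inu ib' cl (le_trans ld dd2)) hd2.
rewrite !ler_norml !ltr_norml => /andP[? ?] /andP[? ?] /andP[? ?].
by apply/andP; split; lra.
Qed.
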